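(* Suppose that $S$ is a normal Suslin tree. Let $T$ and $U$ be normal Aronszajn trees such that $\Vdash_S$ ''$T$ and $U$ are Aronszajn''. Then $\Vdash_{\mathbb{Q}(T,U)}$ ''$S$ is Suslin''.
   Context: An Aronszajn tree is a tree of height $\omega_1$ with countable levels and no cofinal branch; a Suslin tree is a tree of height $\omega_1$ with no uncountable chain or antichain. A tree is normal if it has a root, every element has at least two immediate successors, every element has elements above it at every higher level, and every chain of limit order type has at most one upper bound. The tree $S$ is regarded as a forcing poset with the reversed order, and $\Vdash_S$ denotes forcing with it. For $x \subseteq \omega_1$, $T \upharpoonright x$ is the set of elements of $T$ with height in $x$. For normal Aronszajn trees $T,U$, $\mathbb{Q}(T,U)$ is the forcing poset of all pairs $(x,f)$ where $x$ is a finite set of countable limit ordinals and $f$ is an injective, strictly increasing ($a <_T b \Rightarrow f(a) <_U f(b)$), height preserving function whose domain is a finite downwards closed subset of $T \upharpoonright x$ and whose values lie in $U$; $(y,g) \le (x,f)$ iff $x \subseteq y$ and $f \subseteq g$. *)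

(* Defs.v *)
From HB Require Import structures.
From mathcomp Require Import all_boot all_order finmap.
From mathcomp Require Import boolp classical_sets.

Set Implicit Arguments.
Unset Strict Implicit.
Unset Printing Implicit Defensive.

Import Order.TTheory.
Local Open Scope order_scope.
Local Open Scope fset_scope.
Local Open Scope fmap_scope.

(* Formulas about ground-model structures.  First-order quantifiers range over
   the elements of a ground-model type X, second-order quantifiers over its
   subsets.  The syntax is parametric in the type [Name X] that stands for the
   subsets of X, so that one and the same formula can be evaluated in the ground
   model ([holds]) and in a generic extension ([forces]).
   [Atom A] is only used for absolute facts about ground-model elements: the
   relations x < y, x <= y and x = y. *)
Inductive formula (Name : Type -> Type) : Type :=
| Atom (A : Prop)
| Mem (X : Type) (x : X) (B : Name X)
| Not (phi : formula Name)
| And (phi psi : formula Name)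
| Or (phi psi : formula Name)
| Imp (phi psi : formula Name)
| All (X : Type) (phi : X -> formula Name)
| Ex (X : Type) (phi : X -> formula Name)
| AllSub (X : Type) (phi : Name X -> formula Name)
| ExSub (X : Type) (phi : Name X -> formula Name).

Arguments Atom {Name} A.

Definition sentence := forall Name : Type -> Type, formula Name.

Declare Scope formula_scope.
Delimit Scope formula_scope with F.
Bind Scope formula_scope with formula.

Notation "⌜ A ⌝" := (Atom A%O) (at level 0, A at level 200) : formula_scope.
Notation "x ∈ B" := (Mem x B) (at level 70, no associativity) : formula_scope.
Notation "¬ phi" := (Not phi) (at level 75, right associativity) : formula_scope.
Notation "phi ∧ psi" := (And phi psi) (at level 80, right associativity)
  : formula_scope.
Notation "phi ∨ psi" := (Or phi psi) (at level 85, right associativity)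
  : formula_scope.
Notation "phi ⇒ psi" := (Imp phi psi) (at level 99, right associativity)
  : formula_scope.
Notation "phi ⇔ psi" := (And (Imp phi psi) (Imp psi phi))
  (at level 95, no associativity) : formula_scope.
Notation "∀ x : X , phi" := (All (fun x : X => phi%F))
  (at level 200, x name, X at level 200, right associativity) : formula_scope.
Notation "∃ x : X , phi" := (Ex (fun x : X => phi%F))
  (at level 200, x name, X at level 200, right associativity) : formula_scope.
Notation "∀ B ⊆ X , phi" := (AllSub (X := X) (fun B => phi%F))
  (at level 200, B name, X at level 69, right associativity) : formula_scope.
Notation "∃ B ⊆ X , phi" := (ExSub (X := X) (fun B => phi%F))
  (at level 200, B name, X at level 69, right associativity) : formula_scope.

Fixpoint eval (phi : formula set) : Prop :=
  match phi with
  | Atom A => A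
  | Mem X x B => B x
  | Not phi => ~ eval phi
  | And phi psi => eval phi /\ eval psi
  | Or phi psi => eval phi \/ eval psi
  | Imp phi psi => eval phi -> eval psi
  | All X phi => forall x : X, eval (phi x)
  | Ex X phi => exists x : X, eval (phi x)
  | AllSub X phi => forall B : set X, eval (phi B)
  | ExSub X phi => exists B : set X, eval (phi B)
  end.

Definition holds (phi : sentence) : Prop := eval (phi set).

Section Forcing.
Context {d : Order.disp_t} (P : porderType d).

(* The nice names for subsets of (the check name of) X: a set B of pairs (x, r)
   denotes, in the extension by a generic filter G, the set of all x such that
   (x, r) is in B for some r in G.  Every subset of X in the extension has such
   a name. *)
Definition name (X : Type) : Type := X -> P -> Prop.

(* The forcing relation; q <= p means that q is the stronger condition. *)
Fixpoint forces_at (p : P) (phi : formula name) : Prop :=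
  match phi with
  | Atom A => A
  | Mem X x B =>
      forall q, q <= p -> exists2 r, r <= q & exists2 s, r <= s & B x s
  | Not phi => forall q, q <= p -> ~ forces_at q phi
  | And phi psi => forces_at p phi /\ forces_at p psi
  | Or phi psi =>
      forall q, q <= p -> exists2 r, r <= q & forces_at r phi \/ forces_at r psi
  | Imp phi psi => forall q, q <= p -> forces_at q phi -> forces_at q psi
  | All X phi => forall x : X, forces_at p (phi x)
  | Ex X phi =>
      forall q, q <= p -> exists2 r, r <= q & exists x : X, forces_at r (phi x)
  | AllSub X phi => forall B : name X, forces_at p (phi B)
  | ExSub X phi =>
      forall q, q <= p ->
        exists2 r, r <= q & exists B : name X, forces_at r (phi B)
  end.

Definition forces (phi : sentence) : Prop :=
  forall p : P, forces_at p (phi name).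

End Forcing.

Section Notions.
Variable Name : Type -> Type.

Local Open Scope formula_scope.

(* The class {x | A x} is countable: some injective partial function from X to
   nat, given by its graph R, is defined on all of it. *)
Definition countableF (X : Type) (A : X -> formula Name) : formula Name :=
  ∃ R ⊆ (X * nat),
    (∀ x : X, A x ⇒ ∃ n : nat, (x, n) ∈ R)
    ∧ (∀ x : X, ∀ m : nat, ∀ n : nat,
         (x, m) ∈ R ∧ (x, n) ∈ R ⇒ ⌜m = n⌝)
    ∧ (∀ x : X, ∀ y : X, ∀ n : nat,
         (x, n) ∈ R ∧ (y, n) ∈ R ⇒ ⌜x = y⌝).

(* The linear order W is (isomorphic to) the first uncountable ordinal. *)
Definition omega1F {dW} (W : orderType dW) : formula Name :=
  (∀ B ⊆ W, (∃ a : W, a ∈ B) ⇒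
     ∃ a : W, a ∈ B ∧ (∀ b : W, b ∈ B ⇒ ⌜a <= b⌝))
  ∧ (∀ a : W, countableF (fun b : W => ⌜b < a⌝))
  ∧ ¬ countableF (fun a : W => ⌜True⌝).

Section Trees.
Context {dW dT : Order.disp_t} (W : orderType dW) (T : porderType dT).

(* The predecessors of each element are well-ordered. *)
Definition treeF : formula Name :=
  ∀ x : T, ∀ B ⊆ T, (∃ y : T, y ∈ B ∧ ⌜y < x⌝) ⇒
    ∃ y : T, y ∈ B ∧ ⌜y < x⌝ ∧
      (∀ z : T, z ∈ B ∧ ⌜z < x⌝ ⇒ ⌜y <= z⌝).

(* x has height a: R is an isomorphism from {y | y < x} to {b | b < a}. *)
Definition heightF (x : T) (a : W) : formula Name :=
  ∃ R ⊆ (T * W),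
    (∀ y : T, ⌜y < x⌝ ⇒ ∃ b : W, ⌜b < a⌝ ∧ (y, b) ∈ R)
    ∧ (∀ b : W, ⌜b < a⌝ ⇒ ∃ y : T, ⌜y < x⌝ ∧ (y, b) ∈ R)
    ∧ (∀ y : T, ∀ z : T, ∀ b : W, ∀ c : W,
         ⌜y < x⌝ ∧ ⌜z < x⌝ ∧ ⌜b < a⌝ ∧ ⌜c < a⌝
         ∧ (y, b) ∈ R ∧ (z, c) ∈ R ⇒
         (⌜y < z⌝ ⇔ ⌜b < c⌝)).

(* T has height W and W is omega_1.  When this is evaluated in an extension, it
   says that the height of T is the omega_1 of the extension. *)
Definition height_omega1F : formula Name :=
  omega1F W
  ∧ (∀ x : T, ∃ a : W, heightF x a)
  ∧ (∀ a : W, ∃ x : T, heightF x a).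

Definition chainF (B : Name T) : formula Name :=
  ∀ x : T, ∀ y : T, x ∈ B ∧ y ∈ B ⇒ ⌜x <= y⌝ ∨ ⌜y <= x⌝.

Definition antichainF (B : Name T) : formula Name :=
  ∀ x : T, ∀ y : T, x ∈ B ∧ y ∈ B ∧ ¬ ⌜x = y⌝ ⇒
    ¬ ⌜x <= y⌝ ∧ ¬ ⌜y <= x⌝.

(* A branch is a maximal chain; it is cofinal when it meets every level. *)
Definition cofinal_branchF (B : Name T) : formula Name :=
  chainF B
  ∧ (∀ x : T, (∀ y : T, y ∈ B ⇒ ⌜x <= y⌝ ∨ ⌜y <= x⌝) ⇒ x ∈ B)
  ∧ (∀ a : W, ∃ x : T, x ∈ B ∧ heightF x a).

Definition AronszajnF : formula Name :=
  treeF ∧ height_omega1F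
  ∧ (∀ a : W, countableF (fun x : T => heightF x a))
  ∧ ¬ (∃ B ⊆ T, cofinal_branchF B).

Definition SuslinF : formula Name :=
  treeF ∧ height_omega1F
  ∧ (∀ B ⊆ T, chainF B ∨ antichainF B ⇒ countableF (fun x : T => x ∈ B)).

End Trees.
End Notions.

Section Sentences.
Context {dW dT : Order.disp_t} (W : orderType dW) (T : porderType dT).

Definition omega1 : sentence := fun Name => omega1F Name W.
Definition Aronszajn : sentence := fun Name => AronszajnF Name W T.
Definition Suslin : sentence := fun Name => SuslinF Name W T.

End Sentences.

Section Normal.
Context {dW dT : Order.disp_t} (W : orderType dW) (T : porderType dT).

Definition has_height (x : T) (a : W) : Prop :=
  holds (fun Name => heightF Name x a).

Definition immediate_succ (x y : T) : Prop :=
  x < y /\ ~ exists z, x < z < y.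

(* A nonempty chain without largest element. *)
Definition limit_chain (C : set T) : Prop :=
  [/\ forall x y, C x -> C y -> x <= y \/ y <= x,
      exists x, C x
    & forall x, C x -> exists2 y, C y & x < y].

Definition minimal_ub (C : set T) (u : T) : Prop :=
  (forall x, C x -> x <= u) /\
  forall v, (forall x, C x -> x <= v) -> ~ v < u.

(* Upper bounds in the last clause are minimal ones: anything above an upper
   bound is again an upper bound, so in a tree satisfying the third clause no
   bounded chain has just one. *)
Definition normal : Prop :=
  [/\ exists r : T, forall x, r <= x,
      forall x : T, exists y z : T,
        [/\ y <> z, immediate_succ x y & immediate_succ x z],
      forall (x : T) (a b : W), has_height x a -> a < b ->
        exists2 y, x < y & has_height y b
    & forall (C : set T) (u v : T), limit_chain C ->
        minimal_ub C u -> minimal_ub C v -> u = v].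

End Normal.

Section ClubIsomorphism.
Context {dW dT dU : Order.disp_t}.
Variables (W : orderType dW) (T : porderType dT) (U : porderType dU).

Definition is_limit (a : W) : Prop :=
  (exists b, b < a) /\ forall b, b < a -> exists c, b < c < a.

(* a belongs to the restriction of T to the levels in x. *)
Definition in_restr (x : {fset W}) (a : T) : Prop :=
  exists2 alpha, alpha \in x & has_height a alpha.

Definition is_condition (p : {fset W} * {fmap T -> U}) : Prop :=
  let: (x, f) := p in
  [/\ forall alpha, alpha \in x -> is_limit alpha,
      forall a, a \in domf f -> in_restr x a,
      forall a b, a \in domf f -> in_restr x b -> b < a -> b \in domf f
    & [/\ injective f,
          forall a b : domf f, val a < val b -> f a < f b
        & forall (a : domf f) (alpha : W),
            has_height (val a) alpha -> has_height (f a) alpha]].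

Record Q := Condition {
  Q_val :> {fset W} * {fmap T -> U};
  Q_valP : `[< is_condition Q_val >]
}.

HB.instance Definition _ := [isSub for Q_val].
HB.instance Definition _ := [Choice of Q by <:].

(* [Q_le q p] : q extends p, i.e. q is the stronger condition. *)
Definition Q_le (q p : Q) : bool :=
  (p.1 `<=` q.1) && `[< forall a, a \in domf p.2 -> q.2.[? a] = p.2.[? a] >].

Lemma Q_le_refl : reflexive Q_le.
Proof. by move=> p; rewrite /Q_le fsubset_refl; apply/asboolP. Qed.

Lemma Q_le_anti : antisymmetric Q_le.
Proof.
move=> p q /andP[/andP[xqp /asboolP fqp] /andP[xpq /asboolP fpq]].
apply: val_inj; case: p q xqp fqp xpq fpq => [[x f] ?] [[y g] ?] /=.
move=> yx fg xy gf; congr pair; first by apply/eqP; rewrite eqEfsubset xy yx.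
apply/fmapP => a; case: (boolP (a \in domf g)) => [/fg //|ag].
case: (boolP (a \in domf f)) => [/gf //|af].
by rewrite !not_fnd.
Qed.

Lemma Q_le_trans : transitive Q_le.
Proof.
move=> q p r /andP[xqp /asboolP fqp] /andP[xrq /asboolP frq].
rewrite /Q_le (fsubset_trans xrq xqp); apply/asboolP => a ar.
have aq : a \in domf q.2 by rewrite -fndSome (frq _ ar) fndSome.
by rewrite (fqp _ aq) (frq _ ar).
Qed.

Fact Q_display : Order.disp_t. Proof. exact: Order.Disp tt tt. Qed.

HB.instance Definition _ := Order.Le_isPOrder.Build Q_display Q
  Q_le_refl Q_le_anti Q_le_trans.

End ClubIsomorphism.

(* Main.v *)
(* Fix a family D of pairs (q, s) with q in Q(T,U) and s in S.  The key fact
   (Q_reflection) is that for suitable limit ordinals d, if d is in the first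
   component of q, s has height at least d and (q, s) is in D, then some (q', s')
   in D has s' < s of height below d and q' compatible with q.  To find it, let q0
   be the part of q below d, and let the tuple a list the elements of level d in
   the domain and range of q.  By ccc-ness of S, s forces that there are
   conditions q' in D extending q0 in the same way, with tuples a' of
   arbitrarily large height above the projection of a to some level c < d.  As T
   and U have no cofinal branch after forcing with S, the tree of tuples with this
   property splits in every coordinate, so that a' can be chosen below level d with
   no entry below the corresponding entry of a.  If c is so large that distinct
   entries of a have distinct projections to level c, then q and q' amalgamate:
   for each level b of q' above the part q0, send the projections to b of the
   entries of a in T to those of their images.

   This preserves omega_1: if q forces that R is an injection of omega_1 into
   omega, apply the key fact to the pairs (q, s) such that q forces that R maps
   the height of s to n.  Similarly every antichain B of S in the extension is
   bounded by d, by considering the pairs such that q forces s to be in B; for a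
   chain B consider the pairs such that q forces some element of B to be
   incomparable with s. *)

Require Import Defs.
From mathcomp Require Import all_boot all_order.
From mathcomp Require Import finmap boolp classical_sets.

Set Implicit Arguments.
Unset Strict Implicit.
Unset Printing Implicit Defensive.

Import Order.TTheory.
Local Open Scope order_scope.

(** * Countability and the first uncountable ordinal *)

Lemma fun_choice (X Y : Type) (P : X -> Y -> Prop) :
  (forall x, exists y, P x y) -> exists f, forall x, P x (f x).
Proof. by move=> /choice[f fP]; exists f. Qed.

Definition cnt {X : Type} (A : X -> Prop) : Prop :=
  exists f : X -> nat, forall x y, A x -> A y -> f x = f y -> x = y.

Section Countable.
Context {X Y : Type}.

Lemma cnt_inj (A : X -> Prop) (B : Y -> Prop) (f : X -> Y) :
  (forall x, A x -> B (f x)) ->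
  (forall x y, A x -> A y -> f x = f y -> x = y) -> cnt B -> cnt A.
Proof.
move=> AB fI [g gI]; exists (g \o f) => x y Ax Ay /= e.
by apply: fI => //; apply: gI => //; apply: AB.
Qed.

Lemma cnt_sub (A B : X -> Prop) : (forall x, A x -> B x) -> cnt B -> cnt A.
Proof. by move=> AB [g gI]; exists g => x y /AB Bx /AB; apply: gI. Qed.

Lemma cnt_bigcup (A : X -> Prop) (B : X -> Y -> Prop) :
  cnt A -> (forall x, A x -> cnt (B x)) -> cnt (fun y => exists2 x, A x & B x y).
Proof.
move=> [f fI] cB.
have [g gI] : exists g : X -> Y -> nat, forall x, A x -> forall y z,
    B x y -> B x z -> g x y = g x z -> y = z.
  apply: (@fun_choice _ _ (fun x (g : Y -> nat) => A x -> forall y z,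
    B x y -> B x z -> g y = g z -> y = z)) => x.
  case: (pselect (A x)) => [/cB [g gI]|nA]; first by exists g.
  by exists (fun=> 0%N).
have [c cP] : exists c : Y -> option X, forall y, (exists2 x, A x & B x y) ->
    exists x, [/\ c y = Some x, A x & B x y].
  apply: (@fun_choice _ _ (fun y (c : option X) => (exists2 x, A x & B x y) ->
    exists x, [/\ c = Some x, A x & B x y])) => y.
  case: (pselect (exists2 x, A x & B x y)) => [[x Ax Bx]|n]; last by exists None.
  by exists (Some x) => _; exists x.
exists (fun y => if c y is Some x then choice.pickle (f x, g x y) else 0%N).
move=> y z /cP [x [-> Ax Bx]] /cP [x' [-> Ax' Bx']].
move=> /(pcan_inj choice.pickleK) [/(fI _ _ Ax Ax') e]; rewrite -e in Bx' *.
exact: gI.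
Qed.

Lemma cnt1 (x : X) : cnt (fun y => y = x).
Proof. by exists (fun=> 0%N) => y z -> ->. Qed.

Lemma cnt_or (A B : X -> Prop) : cnt A -> cnt B -> cnt (fun x => A x \/ B x).
Proof.
move=> [f fI] [g gI].
exists (fun x => if pselect (A x) then (f x).*2 else (g x).*2.+1) => x y.
case: pselect => Ax; case: pselect => Ay /=.
- by move=> _ _ /double_inj /fI; apply.
- by move=> _ _ /(congr1 odd); rewrite /= !odd_double.
- by move=> _ _ /(congr1 odd); rewrite /= !odd_double.
- by case=> // Bx [//|By]; case=> /double_inj /gI; apply.
Qed.

Lemma cnt_pair (A : X -> Prop) (B : Y -> Prop) :
  cnt A -> cnt B -> cnt (fun z => A z.1 /\ B z.2).
Proof.
move=> [f fI] [g gI]; exists (fun z => choice.pickle (f z.1, g z.2)).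
move=> [x y] [x' y'] /= [Ax By] [Ax' By'] /(pcan_inj choice.pickleK) [e1 e2].
by rewrite (fI _ _ Ax Ax' e1) (gI _ _ By By' e2).
Qed.

Lemma cnt_sum (A : X -> Prop) (B : Y -> Prop) :
  cnt A -> cnt B ->
  cnt (fun z : X + Y => match z with inl x => A x | inr y => B y end).
Proof.
move=> [f fI] [g gI].
exists (fun z => match z with inl x => (f x).*2 | inr y => (g y).*2.+1 end).
case=> [x|y] [x'|y'] h h'.
- by move/double_inj/(fI _ _ h h') => ->.
- by move/(congr1 odd); rewrite /= !odd_double.
- by move/(congr1 odd); rewrite /= !odd_double.
- by case=> /double_inj/(gI _ _ h h') => ->.
Qed.

End Countable.

Lemma cnt_nat (A : nat -> Prop) : cnt A.
Proof. by exists id. Qed.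

Lemma cnt_image (X Y : Type) (A : X -> Prop) (f : X -> Y) :
  cnt A -> cnt (fun y => exists2 x, A x & y = f x).
Proof. by move=> cA; apply: (cnt_bigcup cA) => x _; apply: cnt1. Qed.

Lemma cnt_seq (X : eqType) (A : X -> Prop) :
  cnt A -> cnt (fun s : seq X => forall x, x \in s -> A x).
Proof.
move=> [f fI]; exists (fun s => choice.pickle (map f s)) => s t.
move=> As At /(pcan_inj choice.pickleK).
elim: s t As At => [|x s IH] [|y t] //= As At [e1 e2]; congr cons.
  by apply: fI e1; [apply: As|apply: At]; rewrite mem_head.
by apply: IH e2 => z zs; [apply: As|apply: At]; rewrite inE zs orbT.
Qed.

Lemma cnt_mem (X : eqType) (s : seq X) : cnt (fun x => x \in s).
Proof.
exists (index^~ s) => x y xs ys e.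
by rewrite -(nth_index x xs) e nth_index.
Qed.

Lemma countableF_cnt (X : Type) (A : X -> formula set) :
  eval (countableF A) <-> cnt (fun x => eval (A x)).
Proof.
split=> [[R /= [Rt [Rf Ri]]]|[f fI]].
  have [f fP] : exists f : X -> nat, forall x, eval (A x) -> R (x, f x).
    apply: (@fun_choice _ _ (fun x (n : nat) => eval (A x) -> R (x, n))) => x.
    case: (pselect (eval (A x))) => [/Rt [n] Rn|nA]; first by exists n.
    by exists 0%N.
  exists f => x y Ax Ay e; apply: (Ri x y (f x)); split; first exact: fP.
  by rewrite e; apply: fP.
exists (fun z => eval (A z.1) /\ f z.1 = z.2) => /=; split; [|split].
- by move=> x Ax; exists (f x).
- by move=> x m n [[_ <-] [_ <-]].
- by move=> x y n [[Ax <-] [Ay e]]; apply: fI.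
Qed.

Section Omega1.
Context {dW : Order.disp_t} (W : orderType dW).

Lemma foldr_max_lt (w0 a : W) (s : seq W) : w0 < a ->
  foldr Order.max w0 s < a <-> forall b, b \in s -> b < a.
Proof.
move=> w0a; elim: s => [|c s IH] /=; first by split=> // _; rewrite w0a.
rewrite gt_max; split.
  by move=> /andP[ca /IH sa] b; rewrite inE => /orP[/eqP->//|]; apply: sa.
move=> h; rewrite h ?mem_head //=; apply/IH => b bs; apply: h.
by rewrite inE bs orbT.
Qed.

Record is_omega1 : Prop := IsOmega1 {
  W_min : forall A : W -> Prop, (exists a, A a) ->
    exists2 a, A a & forall b, A b -> a <= b;
  W_ini : forall a : W, cnt (fun b : W => b < a);
  W_unc : ~ cnt (fun a : W => True) }.

Lemma omega1P : holds (omega1 W) -> is_omega1.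
Proof.
move=> [h1 [h2 h3]]; split.
- move=> A [a Aa]; have [|b /= [Ab bm]] := h1 A; first by exists a.
  by exists b.
- by move=> a; apply: (countableF_cnt (fun b : W => Atom (b < a))).1 (h2 a).
- by move=> h; apply/h3/(countableF_cnt (fun=> Atom True)).
Qed.

Hypothesis hW : is_omega1.

Lemma W_ini_le (a : W) : cnt (fun b : W => b <= a).
Proof.
apply: (cnt_sub _ (cnt_or (W_ini hW a) (cnt1 a))) => b.
by rewrite le_eqVlt => /orP[/eqP|]; [right|left].
Qed.

(** Otherwise [W] would be the union of the countably many countable initial segments determined by
    [A]. *)
Lemma cnt_bounded (A : W -> Prop) : cnt A -> exists a, forall b, A b -> b < a.
Proof.
move=> cA; apply: contrapT => nb; apply: (W_unc hW).
apply: (cnt_sub _ (cnt_bigcup cA (fun a _ => W_ini_le a))) => c _.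
apply: contrapT => nc; apply: nb; exists c => b Ab.
by rewrite ltNge; apply/negP => cb; apply: nc; exists b.
Qed.

Lemma cnt_bounded_fam (X : Type) (A : X -> Prop) (h : X -> W) :
  cnt A -> exists a, forall x, A x -> h x < a.
Proof.
move=> cA; have [a aP] := cnt_bounded (cnt_image h cA).
by exists a => x Ax; apply: aP; exists x.
Qed.

Lemma W_gt (a : W) : exists b, a < b.
Proof. by have [b bP] := cnt_bounded (cnt1 a); exists b; apply: bP. Qed.

Lemma W_bot : exists w0 : W, forall a, w0 <= a.
Proof.
have [] := @W_min hW (fun=> True); last by move=> a _ am; exists a => b; apply: am.
apply: contrapT => nW; apply: (W_unc hW); exists (fun=> 0%N) => a.
by case: nW; exists a.
Qed.

Lemma W_ind (P : W -> Prop) :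
  (forall a, (forall b, b < a -> P b) -> P a) -> forall a, P a.
Proof.
move=> IH a; apply: contrapT => na.
have [|b nb bm] := @W_min hW (fun a => ~ P a); first by exists a.
apply: nb; apply: IH => c cb; apply: contrapT => /bm.
by rewrite leNgt cb.
Qed.

(** A closing-off argument: [d] is the supremum of the iterates from [a0] of a function [g] that
    satisfies [a < g a] and bounds [h] on each initial segment. *)
Lemma club_closed (X : Type) (lev h : X -> W) (a0 : W) :
  (forall a, cnt (fun x => lev x < a)) ->
  exists d, [/\ a0 < d, is_limit d & forall x, lev x < d -> h x < d].
Proof.
move=> clev.
have [g gP] : exists g : W -> W,
    forall a, a < g a /\ forall x, lev x < a -> h x < g a.
  apply: (@fun_choice _ _ (fun a b => a < b /\ forall x, lev x < a -> h x < b)) => a.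
  have [b bP] := cnt_bounded_fam h (clev a).
  have [c cP] := W_gt (Order.max a b).
  move: cP; rewrite gt_max => /andP[ac bc]; exists c; split=> // x /bP xb.
  exact: lt_trans xb bc.
pose s n := iter n g a0.
have sS n : s n < s n.+1 by have [] := gP (s n).
have [b bP] := cnt_bounded_fam s (cnt_nat (fun=> True)).
have [|d dP dm] := @W_min hW (fun d => forall n, s n <= d).
  by exists b => n; apply: ltW; apply: bP.
have sd n : s n < d by apply: lt_le_trans (sS n) (dP _).
have below c : c < d -> exists n, c < s n.
  move=> cd; apply: contrapT => nc.
  have /dm : forall n, s n <= c.
    by move=> n; rewrite leNgt; apply/negP => cs; apply: nc; exists n.
  by rewrite leNgt cd.
exists d; split; first exact: (sd 0%N).
  split; first by exists a0; apply: (sd 0%N).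
  by move=> c /below[n cn]; exists (s n); rewrite cn sd.
move=> x /below[n xn]; have [_ /(_ x xn) hx] := gP (s n).
exact: lt_trans hx (sd n.+1).
Qed.

End Omega1.
(** * Trees and forests *)

Section Forest.
Context {dW : Order.disp_t} (W : orderType dW).

(** Several roots are allowed, so that the disjoint sum of [T] and [U] is again a forest and one
    tuple can mix entries of both trees. *)
Record is_forest (V : Type) (le : V -> V -> Prop) (ht : V -> W) : Prop := IsForest {
  forest_refl : forall x, le x x;
  forest_trans : forall y x z, le x y -> le y z -> le x z;
  forest_ht : forall x y, le x y -> ht x <= ht y;
  forest_eq : forall x y, le x y -> ht x = ht y -> x = y;
  forest_proj : forall x a, a <= ht x -> exists2 y, le y x & ht y = a;
  forest_lin : forall x y z, le y x -> le z x -> ht y <= ht z -> le y z;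
  forest_cnt : forall a, cnt (fun x => ht x = a) }.

Lemma forest_cnt_lt (hW : is_omega1 W) V le ht (F : @is_forest V le ht) a :
  cnt (fun x => ht x < a).
Proof.
apply: (cnt_sub _ (cnt_bigcup (W_ini hW a) (fun b _ => forest_cnt F b))) => x xa.
by exists (ht x).
Qed.

Lemma forest_same V le ht (F : @is_forest V le ht) x y z :
  le x z -> le y z -> ht x = ht y -> x = y.
Proof.
by move=> xz yz e; apply: (forest_eq F) => //; apply: (forest_lin F xz yz); rewrite e.
Qed.

Lemma forest_comp V le ht (F : @is_forest V le ht) x y z :
  le x z -> le y z -> le x y \/ le y x.
Proof.
move=> xz yz; case: (leP (ht x) (ht y)) => h; first by left; apply: (forest_lin F xz).
by right; apply: (forest_lin F yz) => //; apply: ltW.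
Qed.

Definition sum_le (V1 V2 : Type) (le1 : V1 -> V1 -> Prop) (le2 : V2 -> V2 -> Prop)
    (x y : V1 + V2) : Prop :=
  match x, y with
  | inl x, inl y => le1 x y
  | inr x, inr y => le2 x y
  | _, _ => False
  end.

Definition sum_ht (V1 V2 : Type) (ht1 : V1 -> W) (ht2 : V2 -> W) (x : V1 + V2) : W :=
  match x with inl x => ht1 x | inr x => ht2 x end.

Lemma sum_forest V1 V2 le1 le2 ht1 ht2 :
  @is_forest V1 le1 ht1 -> @is_forest V2 le2 ht2 ->
  is_forest (sum_le le1 le2) (sum_ht ht1 ht2).
Proof.
move=> F1 F2; split.
- by case=> x /=; [apply: (forest_refl F1)|apply: (forest_refl F2)].
- by case=> y [] x [] z //=; [apply: (forest_trans F1)|apply: (forest_trans F2)].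
- by case=> x [] y //=; [apply: (forest_ht F1)|apply: (forest_ht F2)].
- by case=> x [] y //= l h; congr (_ _); [apply: (forest_eq F1)|apply: (forest_eq F2)].
- case=> x a /= h.
    by have [y yx ya] := forest_proj F1 h; exists (inl y).
  by have [y yx ya] := forest_proj F2 h; exists (inr y).
- by case=> x [] y [] z //=; [apply: (forest_lin F1)|apply: (forest_lin F2)].
- move=> a; apply: (cnt_sub _ (cnt_sum (forest_cnt F1 a) (forest_cnt F2 a))).
  by case.
Qed.

End Forest.

Section Trees.
Context {dW dT : Order.disp_t} (W : orderType dW) (T : porderType dT).
Hypothesis hW : is_omega1 W.
Hypothesis treeT : holds (fun Name => treeF Name T).

Lemma tree_comp (x y z : T) : y < x -> z < x -> y <= z \/ z <= y.
Proof.
move=> yx zx; have [|w /= [wyz [_ wm]]] := @treeT x (fun w => w = y \/ w = z).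
  by exists y; split; [left|].
by case: wyz wm => -> wm; [left|right]; apply: wm; split=> //; [right|left].
Qed.

Lemma has_height_lt (x : T) (a : W) : has_height x a ->
  (forall y, y < x -> exists2 b, b < a & has_height y b) /\
  (forall b, b < a -> exists2 y, y < x & has_height y b).
Proof.
move=> [R /= [Rt [Rs Ro]]].
have sub y b : y < x -> b < a -> R (y, b) -> has_height y b.
  move=> yx ba Ryb; exists R => /=; split; [|split].
  - move=> z zy; have zx := lt_trans zy yx; have [c [ca Rzc]] := Rt z zx.
    exists c; split=> //.
    by have [h _] := Ro z y c b (conj zx (conj yx (conj ca (conj ba (conj Rzc Ryb)))));
      apply: h.
  - move=> c cb; have ca := lt_trans cb ba; have [z [zx Rzc]] := Rs c ca.
    exists z; split=> //.
    by have [_ h] := Ro z y c b (conj zx (conj yx (conj ca (conj ba (conj Rzc Ryb)))));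
      apply: h.
  - move=> z w c c' [zy [wy [cb [c'b [Rz Rw]]]]].
    apply: Ro; do !split=> //; [exact: lt_trans yx|exact: lt_trans yx| |];
      exact: lt_trans ba.
split.
  by move=> y yx; have [b [ba Ryb]] := Rt y yx; exists b => //; apply: sub.
by move=> b ba; have [y [yx Ryb]] := Rs b ba; exists y => //; apply: sub.
Qed.

Lemma height_uniq (x : T) (a b : W) : has_height x a -> has_height x b -> a = b.
Proof.
move=> [R /= [Rt [Rs Ro]]] [R' /= [Rt' [Rs' Ro']]].
(* By induction the isomorphisms [R] and [R'] agree. If, say, [a < b], the element that [R'] maps to
   [a] would then also have [R]-value [a], although all values of [R] are below [a]. *)
have same : forall c z c', z < x -> c < a -> c' < b -> R (z, c) -> R' (z, c') -> c = c'.
  apply: (W_ind hW) => c IH z c' zx ca c'b Rz Rz'.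
  case: (ltgtP c c') => // cc'.
    have cb := lt_trans cc' c'b; have [w [wx Rw']] := Rs' c cb.
    have [_ /(_ cc') wz] := Ro' w z c c'
      (conj wx (conj zx (conj cb (conj c'b (conj Rw' Rz'))))).
    have [e [ea Rw]] := Rt w wx.
    have [/(_ wz) ec _] := Ro w z e c (conj wx (conj zx (conj ea (conj ca (conj Rw Rz))))).
    by have ee := IH e ec w c wx ea cb Rw Rw'; rewrite ee ltxx in ec.
  have c'a := lt_trans cc' ca; have [w [wx Rw]] := Rs c' c'a.
  have [_ /(_ cc') wz] := Ro w z c' c
    (conj wx (conj zx (conj c'a (conj ca (conj Rw Rz))))).
  have [e [eb Rw']] := Rt' w wx.
  have [/(_ wz) ec _] := Ro' w z e c'
    (conj wx (conj zx (conj eb (conj c'b (conj Rw' Rz'))))).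
  by have ee := IH c' cc' w e wx c'a eb Rw Rw'; rewrite -ee ltxx in ec.
case: (ltgtP a b) => // ab.
  have [z [zx Rz']] := Rs' a ab; have [c [ca Rz]] := Rt z zx.
  by have e := same c z a zx ca ab Rz Rz'; rewrite e ltxx in ca.
have [z [zx Rz]] := Rs b ab; have [c [cb Rz']] := Rt' z zx.
by have e := same b z c zx ab cb Rz Rz'; rewrite -e ltxx in cb.
Qed.

Lemma tree_is_forest :
  (forall x : T, exists a : W, has_height x a) ->
  (forall a : W, cnt (fun x : T => has_height x a)) ->
  exists ht : T -> W, (forall x a, has_height x a <-> ht x = a) /\
    is_forest (fun x y : T => x <= y) ht.
Proof.
move=> tot lev; have [ht htP] := fun_choice tot.
have hE x a : has_height x a <-> ht x = a.
  by split=> [|<- //]; apply: height_uniq.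
have hlt x y : x < y -> ht x < ht y.
  move=> xy; have [h _] := has_height_lt (htP y).
  by have [b + /hE e] := h x xy; rewrite e.
exists ht; split=> //; split.
- by move=> x.
- by move=> y x z; apply: le_trans.
- by move=> x y; rewrite le_eqVlt => /orP[/eqP->//|/hlt/ltW].
- move=> x y; rewrite le_eqVlt => /orP[/eqP//|/hlt + e]; by rewrite e ltxx.
- move=> x a; rewrite le_eqVlt => /orP[/eqP->|ax]; first by exists x.
  have [_ /(_ a ax) [y /ltW yx /hE ya]] := has_height_lt (htP x); by exists y.
- move=> x y z; rewrite le_eqVlt => /orP[/eqP->|yx].
    rewrite le_eqVlt => /orP[/eqP->//|/hlt zx]; by rewrite leNgt zx.
  rewrite le_eqVlt => /orP[/eqP->|zx]; first by move=> _; apply: ltW.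
  have [//|] := tree_comp yx zx; rewrite le_eqVlt => /orP[/eqP->//|/hlt zy].
  by rewrite leNgt zy.
- by move=> a; apply: (cnt_sub _ (lev a)) => x /hE.
Qed.

End Trees.

(** * Consequences of normality *)

Section NormalTree.
Context {dW dT : Order.disp_t} (W : orderType dW) (T : porderType dT).
Variable ht : T -> W.
Hypothesis htE : forall x a, has_height x a <-> ht x = a.
Hypothesis F : is_forest (fun x y : T => x <= y) ht.
Hypothesis nT : normal W T.

Lemma tree_ht_lt (x y : T) : x < y -> ht x < ht y.
Proof.
move=> xy; rewrite lt_neqAle (forest_ht F (ltW xy)) andbT.
by apply/eqP => /(forest_eq F (ltW xy)) e; rewrite e ltxx in xy.
Qed.

Lemma normal_ext (x : T) (a : W) : ht x <= a -> exists2 y, x <= y & ht y = a.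
Proof.
rewrite le_eqVlt => /orP[/eqP<-|xa]; first by exists x.
have [_ _ h _] := nT; have [y /ltW xy /htE ya] := h x (ht x) a ((htE x _).2 erefl) xa.
by exists y.
Qed.

(** If common predecessors of [x] and [y] reached arbitrarily high below [d], the predecessors of
    [x] would form a limit chain with both [x] and [y] as minimal upper bounds, against
    normality. *)
Lemma normal_split (x y : T) (d : W) :
  ht x = d -> ht y = d -> is_limit d -> x <> y ->
  exists2 c, c < d & forall z, z <= x -> z <= y -> ht z < c.
Proof.
move=> xd yd [[b0 b0d] dlim] nxy; apply: contrapT => nc.
have common c : c < d -> exists z, [/\ z < x, z < y & c < ht z].
  move=> /dlim [c' /andP[cc' c'd]]; apply: contrapT => nz; apply: nc.
  exists c' => // z zx zy; rewrite ltNge; apply/negP => c'z; apply: nz; exists z.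
  split; last exact: lt_le_trans c'z.
    rewrite lt_neqAle zx andbT; apply/eqP => e; apply: nxy.
    by apply: (forest_eq F); rewrite ?xd ?yd -?e.
  rewrite lt_neqAle zy andbT; apply/eqP => e; apply: nxy.
  by apply/esym/(forest_eq F); rewrite ?xd ?yd -?e.
have no_lower v : ht v < d -> (forall z, z < x -> z <= v) -> False.
  move=> /common[z [zx _ vz]] /(_ z zx) /(forest_ht F).
  by rewrite leNgt vz.
have [_ _ _ /(_ (fun z => z < x) x y) H] := nT; apply/nxy/H.
- split.
  + by move=> z w /ltW zx /ltW wx; apply: (forest_comp F zx wx).
  + by have [z [zx _ _]] := common b0 b0d; exists z.
  + move=> v vx; have /common[z [zx _ vz]] : ht v < d by rewrite -xd tree_ht_lt.
    exists z => //; rewrite lt_neqAle (forest_lin F (ltW vx) (ltW zx) (ltW vz)) andbT.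
    by apply/eqP => e; rewrite e ltxx in vz.
- split; first by move=> z /ltW.
  by move=> v vub /tree_ht_lt; rewrite xd => /no_lower; apply.
- split; last by move=> v vub /tree_ht_lt; rewrite yd => /no_lower; apply.
  move=> z zx; have /common[w [wx wy zw]] : ht z < d by rewrite -xd tree_ht_lt.
  exact: le_trans (forest_lin F (ltW zx) (ltW wx) (ltW zw)) (ltW wy).
Qed.

End NormalTree.
(** * Reflection of tuples along a Suslin tree *)

Section Suslin.
Context {dW dS : Order.disp_t} (W : orderType dW) (S : porderType dS).
Hypothesis hW : is_omega1 W.
Variable hts : S -> W.
Hypothesis FS : is_forest (fun x y : S => x <= y) hts.
Hypothesis extS : forall (x : S) (a : W), hts x <= a -> exists2 y, x <= y & hts y = a.
Hypothesis accS : forall A : S -> Prop,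
  (forall x y, A x -> A y -> x <= y -> x = y) -> cnt A.

(** This is where the countable chain condition of [S] enters. The minimal elements [s] with [P s a]
    for some [a] form an antichain, hence a countable set. Any [s] higher than all of them lies
    above one of them and inherits [P] from it, and the countably many values of [a] have a common
    bound. *)
Lemma suslin_dense (P : S -> W -> Prop) :
  (forall s t a b, s <= t -> a <= b -> P s a -> P t b) ->
  (forall s, exists t a, s <= t /\ P t a) ->
  exists a, forall s, a <= hts s -> P s a.
Proof.
move=> mono dense; pose E s := exists a, P s a.
pose A s := E s /\ forall t, t < s -> ~ E t.
have cA : cnt A.
  apply: accS => x y [Ex _] [_ my]; rewrite le_eqVlt => /orP[/eqP//|/my].
  by move/(_ Ex).
have min_E : forall a t, hts t = a -> E t -> exists2 m, m <= t & A m.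
  apply: (W_ind hW) => a IH t ta Et.
  case: (pselect (exists2 u, u < t & E u)) => [[u ut Eu]|nu].
    have ua : hts u < a.
      rewrite -ta lt_neqAle (forest_ht FS (ltW ut)) andbT.
      by apply/eqP => /(forest_eq FS (ltW ut)) e; rewrite e ltxx in ut.
    have [m mu Am] := IH _ ua u erefl Eu.
    by exists m => //; apply: le_trans mu (ltW ut).
  by exists t => //; split=> // u ut Eu; apply: nu; exists u.
have [f fP] : exists f : S -> W, forall s, E s -> P s (f s).
  apply: (@fun_choice _ _ (fun s a => E s -> P s a)) => s.
  by case: (pselect (E s)) => [[a Pa]|nE]; [exists a|exists (hts s)].
have [a aP] := cnt_bounded_fam hW hts cA.
have [b bP] := cnt_bounded_fam hW f cA.
exists (Order.max a b) => s; rewrite ge_max => /andP[as_ bs].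
have [t [c [st Pt]]] := dense s.
have [m mt Am] := min_E _ t erefl (ex_intro _ c Pt).
have [ms|sm] := forest_comp FS mt st.
  apply: (mono m s (f m)) => //; first by rewrite le_max (ltW (bP _ Am)) orbT.
  by apply: fP; case: Am.
have := lt_le_trans (aP _ Am) as_; by rewrite ltNge (forest_ht FS sm).
Qed.

(* In the extension by S there is no cofinal branch through the forest:
   B is a name of a chain, and the second hypothesis says that s0 forces this
   chain to meet every level. *)
Definition no_branch_name (V : Type) (le : V -> V -> Prop) (ht : V -> W) : Prop :=
  forall (s0 : S) (B : V -> S -> Prop),
    (forall x s t, s <= t -> B x s -> B x t) ->
    (forall s b, s0 <= s -> exists t x, [/\ s <= t, B x t & ht x = b]) ->
    (forall t x y, s0 <= t -> B x t -> B y t -> le x y \/ le y x) -> False.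

(** Some [t] decides a member of the chain. Beyond [t] the whole chain stays in the summand of that
    member and names a cofinal chain there. *)
Lemma sum_no_branch_name V1 V2 le1 le2 ht1 ht2 :
  @no_branch_name V1 le1 ht1 -> @no_branch_name V2 le2 ht2 ->
  no_branch_name (sum_le le1 le2) (sum_ht ht1 ht2).
Proof.
move=> n1 n2 s0 B mono meets ch.
have [t [[x|x] [st Bx _]]] := meets s0 (hts s0) (lexx _).
- apply: (n1 t (fun y => B (inl y))).
  + by move=> y; apply: mono.
  + move=> s b ts; have [t' [[y|y] [st' By yb]]] := meets s b (le_trans st ts).
      by exists t', y.
    by have [] := ch t' _ _ (le_trans (le_trans st ts) st')
      (mono _ _ _ (le_trans ts st') Bx) By.
  + by move=> t' y z tt' By Bz; apply: (ch t' _ _ (le_trans st tt') By Bz).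
- apply: (n2 t (fun y => B (inr y))).
  + by move=> y; apply: mono.
  + move=> s b ts; have [t' [[y|y] [st' By yb]]] := meets s b (le_trans st ts).
      by have [] := ch t' _ _ (le_trans (le_trans st ts) st')
        (mono _ _ _ (le_trans ts st') Bx) By.
    by exists t', y.
  + by move=> t' y z tt' By Bz; apply: (ch t' _ _ (le_trans st tt') By Bz).
Qed.

Section Tuples.
Variables (V : eqType) (v0 : V) (le : V -> V -> Prop) (ht : V -> W).
Hypothesis FV : is_forest le ht.

Definition seq_below (ys xs : seq V) : Prop :=
  size ys = size xs /\ forall i, (i < size ys)%N -> le (nth v0 ys i) (nth v0 xs i).

Lemma seq_below_refl xs : seq_below xs xs.
Proof. by split=> // i _; apply: (forest_refl FV). Qed.

Lemma seq_below_trans ys xs zs : seq_below xs ys -> seq_below ys zs -> seq_below xs zs.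
Proof.
move=> [e1 l1] [e2 l2]; split; first by rewrite e1.
by move=> i ix; apply: (forest_trans FV (l1 i ix)); apply: l2; rewrite -e1.
Qed.

Lemma seq_proj xs b : (forall x, x \in xs -> b <= ht x) ->
  exists2 zs, seq_below zs xs & forall z, z \in zs -> ht z = b.
Proof.
move=> bxs; have [c cP] : exists c : V -> V, forall x, b <= ht x -> le (c x) x /\ ht (c x) = b.
  apply: (@fun_choice _ _ (fun x y => b <= ht x -> le y x /\ ht y = b)) => x.
  case: (boolP (b <= ht x)) => [bx|_]; last by exists x.
  by have [y yx yb] := forest_proj FV bx; exists y.
exists (map c xs).
  split; first by rewrite size_map.
  move=> i; rewrite size_map => ix; rewrite (nth_map v0) //.
  by have [] := cP (nth v0 xs i) (bxs _ (mem_nth _ ix)).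
by move=> z /mapP[x xxs ->]; have [] := cP x (bxs x xxs).
Qed.

Lemma seq_below_lin xs ys zs b : seq_below ys xs -> seq_below zs xs ->
  (forall y, y \in ys -> ht y <= b) -> (forall z, z \in zs -> ht z = b) ->
  seq_below ys zs.
Proof.
move=> [e1 l1] [e2 l2] yb zb; split; first by rewrite e1.
move=> i iy; have iz : (i < size zs)%N by rewrite e2 -e1.
apply: (forest_lin FV (l1 i iy) (l2 i iz)).
by rewrite (zb _ (mem_nth _ iz)); apply: yb; apply: mem_nth.
Qed.

Section Families.
Variables (K : Type) (lev : K -> W).
Hypothesis levK : forall a, cnt (fun k => lev k < a).
Variables (D : K -> S -> seq V -> Prop) (e : K -> S -> seq V -> W).
Hypothesis NB : no_branch_name le ht.

(* With X the name of the set of all xs such that D k s xs for some s in the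
   generic branch, [stop k t ys a] says that t forces all members of X above ys
   to have an entry of height below a, and [large k t ys] that t forces X to
   have members above ys of arbitrarily large height. *)
Definition stop k t ys a : Prop :=
  forall t' s' xs, t <= t' -> s' <= t' -> D k s' xs -> seq_below ys xs ->
    ~ (forall x, x \in xs -> a <= ht x).

Definition large k t ys : Prop := forall t' a, t <= t' -> ~ stop k t' ys a.

Lemma stop_mono k s t ys zs a b : s <= t -> seq_below ys zs -> a <= b ->
  stop k s ys a -> stop k t zs b.
Proof.
move=> st yz ab h t' s' xs tt' st' Dx zx bx.
apply: (h t' s' xs (le_trans st tt') st' Dx (seq_below_trans yz zx)).
by move=> x /bx; apply: le_trans.
Qed.

Lemma large_mono k s t ys : s <= t -> large k s ys -> large k t ys.
Proof. by move=> st h t' a tt'; apply: h; apply: le_trans tt'. Qed.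

Lemma not_large k t ys : ~ large k t ys -> exists2 t', t <= t' & exists a, stop k t' ys a.
Proof.
move=> nl; apply: contrapT => n; apply: nl => t' a tt' h; apply: n.
by exists t' => //; exists a.
Qed.

(** The alternative is dense, because a condition that does not force largeness has an extension
    that forces a bound; [suslin_dense] then gives one height from which it is decided. *)
Lemma large_or_stop k ys :
  exists a, forall s, a <= hts s -> large k s ys \/ stop k s ys a.
Proof.
apply: (@suslin_dense (fun s a => large k s ys \/ stop k s ys a)).
  move=> s t a b st ab [h|h]; [left|right]; first exact: large_mono h.
  exact: stop_mono (seq_below_refl _) ab h.
move=> s; case: (pselect (large k s ys)) => [h|/not_large[t st [a h]]].
  by exists s, (hts s); split; [|left].
by exists t, a; split; [|right].
Qed.

Lemma not_stop k t ys a : ~ stop k t ys a -> exists t' s' xs,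
  [/\ t <= t', s' <= t', D k s' xs, seq_below ys xs & forall x, x \in xs -> a <= ht x].
Proof.
move=> h; apply: contrapT => n; apply: h => t' s' xs tt' s't Dx yx ax.
by apply: n; exists t', s', xs.
Qed.

(** There are only countably many tuples of level [b], so one [a] exceeds the bounds of
    [large_or_stop] for all of them. A member of the family above [ys] with entries of height at
    least [a] and [b] projects to a tuple of level [b] that cannot be stopped. *)
Lemma large_extend k t ys b : large k t ys -> (forall y, y \in ys -> ht y <= b) ->
  exists t' zs, [/\ t <= t', seq_below ys zs, (forall z, z \in zs -> ht z = b)
    & large k t' zs].
Proof.
move=> lt yb; apply: contrapT => n.
have [f fP] := fun_choice (large_or_stop k).
have [a aP] := cnt_bounded_fam hW f (cnt_seq (forest_cnt FV b)).
have [|t3 tt3 t3a] := @extS t (Order.max a (hts t)); first by rewrite le_max lexx orbT.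
have ht3 : a <= hts t3 by rewrite t3a le_max lexx.
have [t4 [s' [xs [t34 s't4 Dx yx bx]]]] := not_stop (lt t3 (Order.max a b) tt3).
have [zs zx zb] : exists2 zs, seq_below zs xs & forall z, z \in zs -> ht z = b.
  by apply: seq_proj => x /bx; rewrite ge_max => /andP[].
have yz := seq_below_lin yx zx yb zb.
have fa := ltW (aP zs zb).
have [lz|st] := fP zs t3 (le_trans fa ht3); first by apply: n; exists t3, zs.
apply: (st t4 s' xs t34 s't4 Dx zx) => x /bx.
by rewrite ge_max => /andP[ax _]; apply: le_trans fa ax.
Qed.

(* Otherwise the i-th entries of the tuples above ys that are forced to be large
   would generate a cofinal branch. *)
Lemma large_split_dense k t ys i : large k t ys -> (i < size ys)%N ->
  exists t' b zs zs', [/\ t <= t', seq_below ys zs /\ seq_below ys zs',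
    large k t' zs /\ large k t' zs',
    (forall z, z \in zs \/ z \in zs' -> ht z = b)
    & nth v0 zs i <> nth v0 zs' i].
Proof.
move=> lt iy; apply: contrapT => n.
have [c ycm] : exists c, forall y, y \in ys -> ht y <= c.
  have [c cP] := cnt_bounded_fam hW ht (cnt_mem ys).
  by exists c => y /cP/ltW.
(* [Br] names the downward closure of the set of i-th entries of large tuples above [ys]. *)
pose Br x s := exists b zs, [/\ seq_below ys zs, large k s zs,
  (forall z, z \in zs -> ht z = b) & le x (nth v0 zs i)].
apply: (NB (s0 := t) (B := Br)).
- move=> x s s' ss' [b [zs [yz lz zb xz]]]; exists b, zs; split=> //.
  exact: large_mono lz.
- move=> s b ts.
  have yb y : y \in ys -> ht y <= Order.max b c by move=> /ycm h; rewrite le_max h orbT.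
  have [t' [zs [st' yz zb lz]]] := large_extend (large_mono ts lt) yb.
  have iz : (i < size zs)%N by rewrite -(proj1 yz).
  have [|x xz xb] := @forest_proj _ _ _ _ _ FV (nth v0 zs i) b.
    by rewrite (zb _ (mem_nth _ iz)) le_max lexx.
  by exists t', x; split=> //; exists (Order.max b c), zs.
- move=> s.
  (* Lift the lower tuple [zs] to a large [ws] on the level of [zs']. Without a split the i-th
     entries of [ws] and [zs'] coincide, so [x] and [y] lie below one element. *)
  have main x y b b' zs zs' : t <= s -> b <= b' ->
      seq_below ys zs -> large k s zs -> (forall z, z \in zs -> ht z = b) ->
      seq_below ys zs' -> large k s zs' -> (forall z, z \in zs' -> ht z = b') ->
      le x (nth v0 zs i) -> le y (nth v0 zs' i) -> le x y \/ le y x.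
    move=> ts bb' yz lz zb yz' lz' zb' xz yz''.
    have [|s' [ws [ss' zw wb lw]]] := @large_extend k s zs b' lz.
      by move=> z /zb ->.
    have iz : (i < size zs)%N by rewrite -(proj1 yz).
    suff e1 : nth v0 ws i = nth v0 zs' i.
      apply: (forest_comp FV _ yz''); rewrite -e1.
      exact: (forest_trans FV xz (zw.2 i iz)).
    apply: contrapT => ne; apply: n; exists s', b', ws, zs'; split=> //.
    + exact: le_trans ts ss'.
    + by split=> //; apply: seq_below_trans zw.
    + by split=> //; apply: large_mono lz'.
    + by move=> z [/wb|/zb'].
  move=> x y ts [b [zs [yz lz zb xz]]] [b' [zs' [yz' lz' zb' xz']]].
  case: (leP b b') => bb'; first exact: (main _ _ b b' zs zs').
  by apply/or_comm; apply: (main _ _ b' b zs' zs) => //; apply: ltW.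
Qed.

(** [suslin_dense] is applied to the alternative of stopping or splitting; stopping contradicts
    largeness. *)
Lemma large_split k ys i : (i < size ys)%N ->
  exists a, forall s, a <= hts s -> large k s ys ->
  exists b zs zs', [/\ b < a, seq_below ys zs /\ seq_below ys zs',
    large k s zs /\ large k s zs',
    (forall z, z \in zs \/ z \in zs' -> ht z = b)
    & nth v0 zs i <> nth v0 zs' i].
Proof.
move=> iy; have [] := @suslin_dense (fun s a => (exists c, stop k s ys c) \/
  exists b zs zs', [/\ b < a, seq_below ys zs /\ seq_below ys zs',
    large k s zs /\ large k s zs',
    (forall z, z \in zs \/ z \in zs' -> ht z = b)
    & nth v0 zs i <> nth v0 zs' i]).
- move=> s t a b st ab [[c h]|[c [zs [zs' [ca yz [l l'] zc ne]]]]]; [left|right].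
    by exists c; apply: stop_mono h => //; apply: seq_below_refl.
  exists c, zs, zs'; split=> //; first exact: lt_le_trans ab.
  by split; [apply: large_mono l|apply: large_mono l'].
- move=> s; case: (pselect (large k s ys)) => [l|/not_large[t st h]].
    have [t [b [zs [zs' [st yz l2 zb ne]]]]] := large_split_dense l iy.
    have [a ba] := W_gt hW b.
    by exists t, a; split=> //; right; exists b, zs, zs'.
  by exists t, (hts t); split=> //; left.
- move=> a aP; exists a => s /aP[[c h] l|//].
  by case: (l s c (lexx _) h).
Qed.

(** Here the alternative to stopping is a member of the family with all its data below [a]. Since
    [hts s' < a <= hts s], the witness [s'] is strictly below [s]. *)
Lemma large_reflect k zs : exists a, forall s, a <= hts s -> large k s zs ->
  exists s' xs, [/\ s' < s, hts s' < a, D k s' xs, seq_below zs xs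
    & (forall x, x \in xs -> ht x < a) /\ e k s' xs < a].
Proof.
have [] := @suslin_dense (fun s a => (exists c, stop k s zs c) \/
  exists s' xs, [/\ s' <= s, hts s' < a, D k s' xs, seq_below zs xs
    & (forall x, x \in xs -> ht x < a) /\ e k s' xs < a]).
- move=> s t a b st ab [[c h]|[s' [xs [s's sa Dx zx [xa ea]]]]]; [left|right].
    by exists c; apply: stop_mono h => //; apply: seq_below_refl.
  exists s', xs; split=> //; [exact: le_trans st|exact: lt_le_trans ab|].
  split; last exact: lt_le_trans ab.
  by move=> x /xa h; apply: lt_le_trans ab.
- move=> s; case: (pselect (large k s zs)) => [l|/not_large[t st h]]; last first.
    by exists t, (hts t); split=> //; left.
  have [t [s' [xs [st s't Dx zx _]]]] := not_stop (l s (hts s) (lexx _)).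
  have [c cP] := cnt_bounded_fam hW ht (cnt_mem xs).
  have [a] := W_gt hW (Order.max c (Order.max (hts s') (e k s' xs))).
  rewrite !gt_max => /and3P[ca sa ea].
  exists t, a; split=> //; right; exists s', xs; split=> //; split=> //.
  by move=> x /cP xc; apply: lt_trans ca.
- move=> a aP; exists a => s sa l; have [[c h]|[s' [xs [s's s'a Dx zx h]]]] := aP s sa.
    by case: (l s c (lexx _) h).
  exists s', xs; split=> //; rewrite lt_neqAle s's andbT.
  by apply/eqP => es; rewrite -es leNgt s'a in sa.
Qed.

(** [d] is a closure point of the bounds from [large_or_stop], [large_split] and [large_reflect]. So
    for parameters below [d] these lemmas apply to [s]: [ys] is large, it can be moved off [xs] one
    coordinate at a time, and the result reflects to a member of the family below [d]. The function
    [e] keeps further data of that member below [d]. *)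
Lemma tuple_reflection (a0 : W) : exists d, [/\ a0 < d, is_limit d &
  forall k s xs ys, lev k < d -> d <= hts s -> (forall x, x \in xs -> ht x = d) ->
    (forall y, y \in ys -> ht y < d) -> seq_below ys xs -> D k s xs ->
  exists s' xs', [/\ s' < s, hts s' < d, D k s' xs', seq_below ys xs' &
    [/\ e k s' xs' < d, (forall x, x \in xs' -> ht x < d) &
    forall i, (i < size ys)%N -> ~ le (nth v0 xs' i) (nth v0 xs i)]]].
Proof.
have [h1 h1P] : exists h : K * seq V -> W, forall p s, h p <= hts s ->
    large p.1 s p.2 \/ stop p.1 s p.2 (h p).
  apply: (@fun_choice _ _ (fun p a => forall s, a <= hts s ->
    large p.1 s p.2 \/ stop p.1 s p.2 a)) => p; exact: large_or_stop.
have [h2 h2P] : exists h : K * seq V * nat -> W, forall p, (p.2 < size p.1.2)%N ->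
    forall s, h p <= hts s -> large p.1.1 s p.1.2 ->
    exists b zs zs', [/\ b < h p, seq_below p.1.2 zs /\ seq_below p.1.2 zs',
      large p.1.1 s zs /\ large p.1.1 s zs',
      (forall z, z \in zs \/ z \in zs' -> ht z = b)
      & nth v0 zs p.2 <> nth v0 zs' p.2].
  apply: (@fun_choice _ _ (fun (p : K * seq V * nat) a => (p.2 < size p.1.2)%N ->
    forall s, a <= hts s -> large p.1.1 s p.1.2 ->
    exists b zs zs', [/\ b < a, seq_below p.1.2 zs /\ seq_below p.1.2 zs',
      large p.1.1 s zs /\ large p.1.1 s zs',
      (forall z, z \in zs \/ z \in zs' -> ht z = b)
      & nth v0 zs p.2 <> nth v0 zs' p.2])) => -[[k ys] i] /=.
  case: (boolP (i < size ys)%N) => [/(large_split k)[a aP]|_]; first by exists a.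
  by exists a0.
have [h3 h3P] : exists h : K * seq V -> W, forall p s, h p <= hts s ->
    large p.1 s p.2 -> exists s' xs, [/\ s' < s, hts s' < h p, D p.1 s' xs,
      seq_below p.2 xs & (forall x, x \in xs -> ht x < h p) /\ e p.1 s' xs < h p].
  apply: (@fun_choice _ _ (fun p a => forall s, a <= hts s ->
    large p.1 s p.2 -> exists s' xs, [/\ s' < s, hts s' < a, D p.1 s' xs,
      seq_below p.2 xs & (forall x, x \in xs -> ht x < a) /\ e p.1 s' xs < a])) => p.
  exact: large_reflect.
have [w0 w0P] := W_bot hW.
(* The least element [w0] serves as the height of the empty tuple. *)
pose levseq (ys : seq V) := foldr Order.max w0 (map ht ys).
have levseqP ys d : w0 < d -> (levseq ys < d) <-> (forall y, y \in ys -> ht y < d).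
  move=> /(foldr_max_lt (map ht ys)) [lo hi]; split.
    by move=> /lo h y yys; apply: h; apply: map_f.
  by move=> h; apply: hi => _ /mapP[y yys ->]; apply: h.
pose lv (p : K * seq V * nat) := Order.max (lev p.1.1) (levseq p.1.2).
pose hh p := Order.max (Order.max (h1 p.1) (h3 p.1)) (h2 p).
have [d [a0d dlim dP]] : exists d, [/\ a0 < d, is_limit d & forall p, lv p < d -> hh p < d].
  apply: (club_closed hW) => a; case: (boolP (w0 < a)) => [w0a|nw0]; last first.
    exists (fun=> 0%N) => p q pa _ _; case/negP: nw0.
    exact: le_lt_trans (w0P _) pa.
  apply: (cnt_sub _ (cnt_pair (cnt_pair (levK a) (cnt_seq (forest_cnt_lt hW FV a)))
    (cnt_nat (fun=> True)))) => -[[k ys] i]; rewrite /lv gt_max /= => /andP[ka ya].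
  by split=> //; split=> //; apply/levseqP.
have w0d : w0 < d by apply: le_lt_trans (w0P _) a0d.
exists d; split=> // k s xs ys kd ds xd yd yx Dx.
have hd zs i : (forall z, z \in zs -> ht z < d) ->
    [/\ h1 (k, zs) < d, h3 (k, zs) < d & h2 (k, zs, i) < d].
  move=> zd; have : hh (k, zs, i) < d.
    by apply: dP; rewrite /lv gt_max /= kd; apply/levseqP.
  by rewrite /hh !gt_max /= => /andP[/andP[-> ->] ->].
(* [xs] itself, with all entries of height [d], refutes stopping at the bound [h1 (k, ys) < d]. *)
have ly : large k s ys.
  have [h1d _ _] := hd ys 0%N yd.
  have [//|/= st] := h1P (k, ys) s (ltW (lt_le_trans h1d ds)).
  case: (st s s xs (lexx _) (lexx _) Dx yx) => x /xd ->; exact: ltW.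
have step j : (j <= size ys)%N -> exists zs, [/\ seq_below ys zs, large k s zs,
    (forall z, z \in zs -> ht z < d) &
    forall i, (i < j)%N -> ~ le (nth v0 zs i) (nth v0 xs i)].
  elim: j => [_|j IH jy]; first by exists ys; split=> //; apply: seq_below_refl.
  have [zs [yz lz zd zx]] := IH (ltnW jy).
  have jz : (j < size zs)%N by rewrite -(proj1 yz).
  have jx : (j < size xs)%N by rewrite -(proj1 yx).
  have [_ _ h2d] := hd zs j zd.
  have [b [us [us' [/= bh [zu zu'] [lu lu'] ub ne]]]] :=
    h2P (k, zs, j) jz s (ltW (lt_le_trans h2d ds)) lz.
  have bd := lt_trans bh h2d.
  have pick vs : seq_below zs vs -> large k s vs -> (forall v, v \in vs -> ht v = b) ->
      ~ le (nth v0 vs j) (nth v0 xs j) -> exists zs, [/\ seq_below ys zs, large k s zs,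
      (forall z, z \in zs -> ht z < d) &
      forall i, (i < j.+1)%N -> ~ le (nth v0 zs i) (nth v0 xs i)].
    move=> zv lv' vb nv; exists vs; split=> //; first exact: seq_below_trans zv.
      by move=> v /vb ->.
    move=> i; rewrite ltnS leq_eqVlt => /orP[/eqP->//|ij] vx.
    apply: (zx i ij); apply: (forest_trans FV _ vx); apply: (proj2 zv).
    exact: ltn_trans jz.
  (* The two tuples of the split have distinct j-th entries of equal height, so at most one of these
     is below the j-th entry of [xs]. *)
  case: (pselect (le (nth v0 us j) (nth v0 xs j))) => [ux|nu]; last first.
    by apply: (pick us) => // u uu; apply: ub; left.
  apply: (pick us') => //; first by move=> u uu; apply: ub; right.
  move=> u'x; apply: ne; apply: (forest_same FV ux u'x).
  rewrite !ub //; first by right; apply: mem_nth; rewrite -(proj1 zu').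
  by left; apply: mem_nth; rewrite -(proj1 zu).
have [zs [yz lz zd zx]] := step _ (leqnn _).
have [_ h3d _] := hd zs 0%N zd.
have [s' [xs' [s's s'd Dx' zx' [/= xd' ed]]]] :=
  h3P (k, zs) s (ltW (lt_le_trans h3d ds)) lz.
exists s', xs'; split=> //; first exact: lt_trans h3d.
  exact: seq_below_trans zx'.
split; first exact: lt_trans h3d.
  by move=> x /xd' h; apply: lt_trans h3d.
move=> i iy x'x; apply: (zx i iy); apply: (forest_trans FV _ x'x).
by apply: (proj2 zx'); rewrite -(proj1 yz).
Qed.

End Families.
End Tuples.
End Suslin.
(** * Amalgamation of conditions *)

Section Amalgam.
Context {dW : Order.disp_t} (W : orderType dW).
Variables (T U : Type) (lT : T -> T -> Prop) (lU : U -> U -> Prop).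
Variables (hT : T -> W) (hU : U -> W).
Hypotheses (FT : is_forest lT hT) (FU : is_forest lU hU).
Variables (G G' A A' : T -> U -> Prop) (d d' : W).

(** [G] and [G'] stand for the two conditions, [A] and [A'] for their parts on levels [d] and [d'].
    The form is symmetric in the two trees, so that order reflection follows from order preservation
    of the converse relation. The third clause covers all levels from [d'] up to [d]; the
    restriction to finitely many comes later. *)
Definition amalgam (a : T) (b : U) : Prop :=
  [\/ G a b /\ d <= hT a, G' a b |
    exists a0 b0, [/\ A a0 b0, lT a a0 /\ lU b b0, hT a = hU b & d' <= hT a < d]].

Hypothesis Ginc : forall a b c e, G a b -> G c e -> lT a c -> lU b e.
Hypothesis G'inc : forall a b c e, G' a b -> G' c e -> lT a c -> lU b e.
Hypothesis Ght : forall a b, G a b -> hU b = hT a.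
Hypothesis AG : forall a b, A a b -> G a b /\ hT a = d.
Hypothesis Gabove : forall a b, G a b -> d <= hT a ->
  exists a0 b0, [/\ A a0 b0, lT a0 a & lU b0 b].
Hypothesis A'ht : forall a b, A' a b -> hT a = d'.
Hypothesis G'below : forall a b, G' a b -> hT a < d' -> G a b.
Hypothesis G'above : forall a b, G' a b -> d' <= hT a ->
  exists a0 b0, [/\ A' a0 b0, lT a0 a & lU b0 b].
Hypothesis G'ht : forall a b, G' a b -> hT a < d.
Hypothesis AA' : forall a b a' b', A a b -> A' a' b' -> ~ lT a' a.
Hypothesis Asplit : forall a b a0 b0 c, A a b -> A a0 b0 -> a <> a0 ->
  lT c a -> lT c a0 -> hT c < d'.

(** Below [d'] the relation [G'] is part of [G]. From [d'] on, a point of [G'] sits above an entry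
    of [A'], so [AA'] keeps it from lying below an entry of [A]. Comparisons of a projection with
    another projection or with [G] rest on [same]. *)
Lemma amalgam_inc a b c e : amalgam a b -> amalgam c e -> lT a c -> lU b e.
Proof.
(* By [Asplit], a point of height at least [d'] lies below at most one first coordinate of [A], and
   this determines the second coordinate. *)
have same x a0 b0 c0 e0 : A a0 b0 -> A c0 e0 -> lT x a0 -> lT x c0 -> d' <= hT x -> b0 = e0.
  move=> A1 A2 xa xc xd; case: (pselect (a0 = c0)) => [ac|ne].
    subst c0; have [G1 _] := AG A1; have [G2 _] := AG A2.
    apply: (forest_eq FU (Ginc G1 G2 (forest_refl FT _))).
    by rewrite (Ght G1) (Ght G2).
  by have := Asplit A1 A2 ne xa xc; rewrite ltNge xd.
move=> [[Gab da]|Gab|[a0 [b0 [A0 [aa0 bb0] hab /andP[d'a ad]]]]]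
  [[Gce dc]|Gce|[c0 [e0 [A1 [cc0 ee0] hce /andP[d'c cd]]]]] ac.
- exact: Ginc ac.
- by have := le_lt_trans (le_trans da (forest_ht FT ac)) (G'ht Gce); rewrite ltxx.
- by have := le_lt_trans (le_trans da (forest_ht FT ac)) cd; rewrite ltxx.
- case: (ltP (hT a) d') => [/(G'below Gab) Gab'|/(G'above Gab)]; first exact: Ginc ac.
  move=> [a1 [b1 [A1 aa1 _]]]; have [c0 [e0 [A0 cc0 _]]] := Gabove Gce dc.
  case: (AA' A0 A1); apply: (forest_lin FT (forest_trans FT aa1 ac) cc0).
  rewrite (proj2 (AG A0)); apply: ltW; apply: le_lt_trans (G'ht Gab).
  exact: forest_ht FT _ _ aa1.
- exact: G'inc ac.
- have ac0 := forest_trans FT ac cc0.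
  case: (ltP (hT a) d') => [ad'|/(G'above Gab) [a1 [b1 [A2 aa1 _]]]]; last first.
    by case: (AA' A1 A2 (forest_trans FT aa1 ac0)).
  have Gab' := G'below Gab ad'.
  apply: (forest_lin FU (Ginc Gab' (proj1 (AG A1)) ac0) ee0).
  by rewrite (Ght Gab') -hce; apply: ltW; apply: lt_le_trans d'c.
- have [c0 [e0 [A1 cc0 ee0]]] := Gabove Gce dc.
  have ac0 : lT a c0 by apply: (forest_lin FT ac cc0); rewrite (proj2 (AG A1)) ltW.
  by apply: forest_trans FU _ _ _ bb0 _; rewrite (same _ _ _ _ _ A0 A1 aa0 ac0).
- have [c0 [e0 [A1 cc0 _]]] := G'above Gce (le_trans d'a (forest_ht FT ac)).
  case: (AA' A0 A1); apply: (forest_trans FT _ aa0).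
  by apply: (forest_lin FT cc0 ac); rewrite (A'ht A1).
- rewrite -(same _ _ _ _ _ A0 A1 aa0 (forest_trans FT ac cc0) d'a) in ee0.
  by apply: (forest_lin FU bb0 ee0); rewrite -hab -hce (forest_ht FT ac).
Qed.

End Amalgam.

(** * Conditions as finite relations between the two trees *)

Section Conditions.
Context {dW dT dU : Order.disp_t}.
Variables (W : orderType dW) (T : porderType dT) (U : porderType dU).
Hypothesis hW : is_omega1 W.
Variables (htT : T -> W) (htU : U -> W).
Hypothesis htTE : forall x a, has_height x a <-> htT x = a.
Hypothesis htUE : forall x a, has_height x a <-> htU x = a.
Hypothesis FT : is_forest (fun x y : T => x <= y) htT.
Hypothesis FU : is_forest (fun x y : U => x <= y) htU.
Local Notation Q := (Q W T U).

Definition gr (q : Q) (a : T) (b : U) : Prop := fnd (Q_val q).2 a = Some b.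

Lemma grP (q : Q) a b :
  gr q a b <-> exists h : domf (Q_val q).2, val h = a /\ (Q_val q).2 h = b.
Proof.
rewrite /gr; split; first by case: fndP => // h [<-]; exists [` h]%fset.
by move=> [h [<- <-]]; rewrite (in_fnd (valP h)); congr (Some (_ _)); apply: val_inj.
Qed.

Lemma gr_fun (q : Q) a b c : gr q a b -> gr q a c -> b = c.
Proof. by rewrite /gr => -> []. Qed.

Lemma in_restrE (x : {fset W}) (a : T) : in_restr x a <-> htT a \in x.
Proof.
split; first by move=> [al alx /htTE ->].
by move=> h; exists (htT a) => //; apply/htTE.
Qed.

Lemma Q_cond (q : Q) : let x := (Q_val q).1 in let f := (Q_val q).2 in
  [/\ forall al, al \in x -> is_limit al,
      forall a, a \in domf f -> in_restr x a,
      forall a b, a \in domf f -> in_restr x b -> b < a -> b \in domf f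
    & [/\ injective f, forall a b : domf f, val a < val b -> f a < f b
      & forall (a : domf f) (al : W), has_height (val a) al -> has_height (f a) al]].
Proof. by case: q => -[x f] /= /asboolP. Qed.

Lemma Q_limit (q : Q) a : a \in (Q_val q).1 -> is_limit a.
Proof. by have [h _ _ _] := Q_cond q; apply: h. Qed.

Lemma gr_dom (q : Q) a b : gr q a b -> htT a \in (Q_val q).1.
Proof.
move=> /grP[h [<- _]]; have [_ H _ _] := Q_cond q.
by apply/in_restrE/H/(valP h).
Qed.

Lemma gr_ht (q : Q) a b : gr q a b -> htU b = htT a.
Proof.
move=> /grP[h [<- <-]]; have [_ _ _ [_ _ H]] := Q_cond q.
by apply/htUE/H/htTE.
Qed.

Lemma gr_down (q : Q) a b c : gr q a b -> c <= a -> htT c \in (Q_val q).1 ->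
  exists2 e, gr q c e & e <= b.
Proof.
move=> g; rewrite le_eqVlt => /orP[/eqP->|ca] cx; first by exists b.
have /grP[h [ea eb]] := g; rewrite -{a}ea in g ca *; rewrite -{b}eb in g *.
have [_ _ H [_ inc _]] := Q_cond q.
have hc : c \in domf (Q_val q).2 by apply: (H (val h) c (valP h) _ ca); apply/in_restrE.
exists ((Q_val q).2 [` hc]%fset); first by apply/grP; exists [` hc]%fset.
exact/ltW/inc.
Qed.

(** For the converse direction, project [c] to the height of [a]. The projection is in the domain,
    and its image lies below [e] at the height of [b], so it equals [b]; injectivity identifies the
    projection with [a]. *)
Lemma gr_iso (q : Q) a b c e : gr q a b -> gr q c e -> a <= c <-> b <= e.
Proof.
move=> g g'; split.
  move=> ac; have [e' ge' e'e] := gr_down g' ac (gr_dom g).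
  by rewrite (gr_fun g ge').
move=> be; have hac : htT a <= htT c by rewrite -(gr_ht g) -(gr_ht g') (forest_ht FU be).
have [a' a'c a'a] := forest_proj FT hac.
have [b' gb' b'e] := gr_down g' a'c (etrans (congr1 _ a'a) (gr_dom g)).
have eb : b' = b.
  by apply: (forest_same FU b'e be); rewrite (gr_ht gb') (gr_ht g).
subst b'; have /grP[h1 [ea1 e1]] := g; have /grP[h2 [ea2 e2]] := gb'.
suff h12 : h2 = h1 by rewrite -ea1 -h12 ea2.
have [_ _ _ [inj _ _]] := Q_cond q.
by apply: inj; rewrite e1 e2.
Qed.

Lemma Q_leP (q p : Q) : q <= p <->
  {subset (Q_val p).1 <= (Q_val q).1} /\ forall a b, gr p a b -> gr q a b.
Proof.
rewrite /Order.le /= /Q_le; split.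
  move=> /andP[/fsubsetP s /asboolP h]; split=> // a b g.
  by rewrite /gr h //; case/grP: g => h' [<- _]; apply: valP.
move=> [s h]; apply/andP; split; first exact/fsubsetP.
by apply/asboolP => a ad; rewrite (in_fnd ad); apply: h; apply/grP; exists [` ad]%fset.
Qed.

(** The equivalence between the two orders yields at once that the pairs of [L] form a function,
    that it is injective and that it is strictly increasing. *)
Lemma mkQ (x : {fset W}) (L : seq (T * U)) :
  (forall al, al \in x -> is_limit al) ->
  (forall a b, (a, b) \in L -> htT a \in x /\ htU b = htT a) ->
  (forall a b c e, (a, b) \in L -> (c, e) \in L -> a <= c <-> b <= e) ->
  (forall a b c, (a, b) \in L -> c < a -> htT c \in x -> exists e, (c, e) \in L) ->
  exists q : Q, (Q_val q).1 = x /\ forall a b, gr q a b <-> (a, b) \in L.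
Proof.
move=> lim hts iso down.
have [f fP] : exists f : {fmap T -> U}, forall a b, fnd f a = Some b <-> (a, b) \in L.
  have: forall a b e, (a, b) \in L -> (a, e) \in L -> b = e.
    move=> a b e ab ae; apply/eqP; rewrite eq_le.
    by rewrite (iso _ _ _ _ ab ae).1 // (iso _ _ _ _ ae ab).1.
  elim: L {hts iso down} => [|[a b] L IH] fn.
    by exists fmap0 => a b; rewrite fnd_fmap0.
  have [|f fP] := IH.
    by move=> c e e' ce ce'; apply: (fn c); rewrite inE ?ce ?ce' orbT.
  exists (setf f a b) => c e; rewrite fnd_set inE xpair_eqE; case: eqP => [->|_] /=.
    split; first by case=> <-; rewrite eqxx.
    move=> ae; congr Some; apply: (fn a); rewrite inE ?eqxx //.
    by rewrite xpair_eqE eqxx.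
  exact: fP.
have fL (a : domf f) : (val a, f a) \in L.
  by apply/fP; rewrite (in_fnd (valP a)); congr (Some (f _)); apply: val_inj.
have Ldom a b : (a, b) \in L -> a \in domf f.
  by move=> /fP; case: fndP.
have cond : is_condition (x, f).
  split=> //.
  - move=> a ad; apply/in_restrE.
    by have [] := hts _ _ (fL [` ad]%fset).
  - move=> a b ad /in_restrE bx ba.
    by have [e /Ldom] := down _ _ b (fL [` ad]%fset) ba bx.
  - split.
    + move=> a b e; apply: val_inj; apply/eqP; rewrite eq_le.
      by rewrite (iso _ _ _ _ (fL a) (fL b)).2 ?e // (iso _ _ _ _ (fL b) (fL a)).2 ?e.
    + move=> a b ab; rewrite lt_neqAle (iso _ _ _ _ (fL a) (fL b)).1 ?ltW // andbT.
      apply/eqP => e.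
      have := (iso _ _ _ _ (fL b) (fL a)).2; rewrite e => /(_ (lexx _)).
      by rewrite (lt_geF ab).
    + move=> a al /htTE <-; apply/htUE.
      by have [] := hts _ _ (fL a).
exists (Condition (introT (asboolP _) cond)); split=> // a b; exact: fP.
Qed.

Lemma gr_seq (q : Q) : exists L : seq (T * U), forall a b, (a, b) \in L <-> gr q a b.
Proof.
exists [seq (val a, (Q_val q).2 a) | a : domf (Q_val q).2] => a b; split.
  by move=> /mapP[a' _ [-> ->]]; apply/grP; exists a'.
by move=> /grP[h [<- <-]]; apply/mapP; exists h; rewrite ?mem_enum.
Qed.

Lemma gr_seq_filter (q : Q) (P : T -> bool) : exists L : seq (T * U),
  forall a b, (a, b) \in L <-> gr q a b /\ P a.
Proof.
have [L LP] := gr_seq q; exists [seq p <- L | P p.1] => a b.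
rewrite mem_filter /=; split; first by move=> /andP[Pa /LP].
by move=> [/LP -> ->].
Qed.

Definition restr_below (q : Q) (d : W) (q0 : Q) : Prop :=
  (forall al, al \in (Q_val q0).1 <-> al \in (Q_val q).1 /\ al < d) /\
  (forall a b, gr q0 a b <-> gr q a b /\ htT a < d).

Lemma restr_below_ex (q : Q) (d : W) : exists q0, restr_below q d q0.
Proof.
have [L LP] := gr_seq_filter q (fun a => htT a < d).
have xP al : al \in [fset al in (Q_val q).1 | al < d]%fset <-> al \in (Q_val q).1 /\ al < d.
  by rewrite !inE /=; split => [/andP[]//|[-> ->]].
have [||||q0 [q01 q02]] := @mkQ [fset al in (Q_val q).1 | al < d]%fset L.
- by move=> al /xP[/Q_limit].
- move=> a b /LP[g ad]; split; last exact: gr_ht g.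
  by apply/xP; split=> //; apply: gr_dom g.
- by move=> a b c e /LP[g _] /LP[g' _]; apply: gr_iso g g'.
- move=> a b c /LP[g ad] ca /xP[cx cd].
  by have [e ge _] := gr_down g (ltW ca) cx; exists e; apply/LP.
exists q0; split; first by move=> al; rewrite q01.
by move=> a b; split => [/q02/LP|/LP/q02].
Qed.

(** The new level is above all old ones, so none of its elements is below the domain and the finite
    function can stay the same. *)
Lemma Q_add_level (q : Q) (d : W) : is_limit d ->
  (forall al, al \in (Q_val q).1 -> al < d) -> exists2 q', q' <= q & d \in (Q_val q').1.
Proof.
move=> dlim qd; have [L LP] := gr_seq q.
have [||||q' [q1 q2]] := @mkQ (d |` (Q_val q).1)%fset L.
- by move=> al; rewrite inE => /orP[|/Q_limit//]; rewrite inE => /eqP->.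
- by move=> a b /LP g; rewrite inE (gr_dom g) orbT (gr_ht g).
- by move=> a b c e /LP g /LP g'; apply: gr_iso g g'.
- move=> a b c /LP g ca; rewrite !inE => /orP[/eqP cd|cx].
    have := le_lt_trans (forest_ht FT (ltW ca)) (qd _ (gr_dom g)).
    by rewrite cd ltxx.
  by have [e ge _] := gr_down g (ltW ca) cx; exists e; apply/LP.
exists q'; last by rewrite q1 !inE eqxx.
apply/Q_leP; split; first by move=> al h; rewrite q1 !inE h orbT.
by move=> a b /LP/q2.
Qed.

Definition Q_compat (q q' : Q) : Prop := exists2 w, w <= q & w <= q'.

(** The common extension is [amalgam] restricted to the levels of [q] and [q']; [amalgam_inc] for it
    and for its converse supplies the order equivalence that [mkQ] asks for. *)
Lemma Q_amalgam (q q' q0 : Q) (d d' : W) :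
  d \in (Q_val q).1 -> d' \in (Q_val q').1 ->
  restr_below q d q0 -> restr_below q' d' q0 ->
  (forall al, al \in (Q_val q').1 -> al < d) ->
  (forall a b a' b', gr q a b -> htT a = d -> gr q' a' b' -> htT a' = d' ->
    ~ a' <= a /\ ~ b' <= b) ->
  (forall a b a0 b0, gr q a b -> htT a = d -> gr q a0 b0 -> htT a0 = d ->
    a <> a0 -> (forall c, c <= a -> c <= a0 -> htT c < d') /\
    (forall c, c <= b -> c <= b0 -> htU c < d')) ->
  Q_compat q q'.
Proof.
move=> dq dq' [r1 r2] [r1' r2'] q'd inc spl.
pose A a b := gr q a b /\ htT a = d.
pose A' a b := gr q' a b /\ htT a = d'.
pose F := amalgam (fun x y : T => x <= y) (fun x y : U => x <= y) htT htU
  (gr q) (gr q') A d d'.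
have Gabove (p : Q) c a b : c \in (Q_val p).1 -> gr p a b -> c <= htT a ->
    exists a0 b0, [/\ gr p a0 b0 /\ htT a0 = c, a0 <= a & b0 <= b].
  move=> cp g ca; have [a0 a0a a0c] := forest_proj FT ca.
  rewrite -a0c in cp; have [b0 g0 b0b] := gr_down g a0a cp.
  by exists a0, b0.
have low' a b : gr q' a b -> htT a < d' -> gr q a b.
  by move=> g ad; have /r2[] : gr q0 a b by apply/r2'.
have low a b : gr q a b -> htT a < d -> gr q' a b.
  by move=> g ad; have /r2'[] : gr q0 a b by apply/r2.
have lowx al : al \in (Q_val q).1 -> al < d -> al \in (Q_val q').1.
  by move=> g ad; have /r1'[] : al \in (Q_val q0).1 by apply/r1.
have lowx' al : al \in (Q_val q').1 -> al < d' -> al \in (Q_val q).1.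
  by move=> g ad; have /r1[] : al \in (Q_val q0).1 by apply/r1'.
have Finc a b c e : F a b -> F c e -> a <= c -> b <= e.
  apply: (@amalgam_inc _ _ _ _ _ _ _ _ FT FU _ _ _ A' d d').
  - by move=> ? ? ? ? g g' h; apply/(gr_iso g g').
  - by move=> ? ? ? ? g g' h; apply/(gr_iso g g').
  - exact: gr_ht.
  - by [].
  - by move=> ? ? g; apply: Gabove g.
  - by move=> ? ? [].
  - exact: low'.
  - by move=> ? ? g; apply: Gabove g.
  - by move=> ? ? /gr_dom/q'd.
  - by move=> ? ? ? ? [g h] [g' h']; case: (inc _ _ _ _ g h g' h').
  - by move=> ? ? ? ? ? [g h] [g' h'] ne ca cb; apply: (proj1 (spl _ _ _ _ g h g' h' ne)).
pose sw (R : T -> U -> Prop) b a := R a b.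
have FswP a b : F a b -> amalgam (fun x y : U => x <= y) (fun x y : T => x <= y) htU htT
    (sw (gr q)) (sw (gr q')) (sw A) d d' b a.
  move=> [[g h]|g|[a0 [b0 [A0 [aa bb] e h]]]].
  - by constructor 1; rewrite (gr_ht g).
  - by constructor 2.
  - by constructor 3; exists b0, a0; rewrite -e.
have Fcni a b c e : F a b -> F c e -> b <= e -> a <= c.
  move=> /FswP h1 /FswP h2 be; move: h1 h2 be.
  apply: (@amalgam_inc _ _ _ _ _ _ _ _ FU FT _ _ _ (sw A') d d'); rewrite /sw.
  - by move=> ? ? ? ? g g' h; apply/(gr_iso g g').
  - by move=> ? ? ? ? g g' h; apply/(gr_iso g g').
  - by move=> ? ? /gr_ht.
  - by move=> ? ? [g h]; rewrite (gr_ht g).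
  - move=> b0 a0 g; rewrite (gr_ht g) => /(Gabove _ _ _ _ dq g)[x [y [? ? ?]]].
    by exists y, x.
  - by move=> ? ? [g h]; rewrite (gr_ht g).
  - by move=> ? ? g; rewrite (gr_ht g); apply: low'.
  - move=> b0 a0 g; rewrite (gr_ht g) => /(Gabove _ _ _ _ dq' g)[x [y [? ? ?]]].
    by exists y, x.
  - by move=> ? ? g; rewrite (gr_ht g); apply: q'd; apply: gr_dom g.
  - by move=> ? ? ? ? [g h] [g' h']; case: (inc _ _ _ _ g h g' h').
  - move=> b0 a0 b1 a1 c0 [g h] [g' h'] ne.
    apply: (proj2 (spl _ _ _ _ g h g' h' _)) => e0; apply: ne; subst a1.
    exact: gr_fun g g'.
have [pT pTP] : exists p : T * W -> T, forall z, z.2 <= htT z.1 ->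
    p z <= z.1 /\ htT (p z) = z.2.
  apply: (@fun_choice _ _ (fun z y => z.2 <= htT z.1 -> y <= z.1 /\ htT y = z.2)).
  move=> [y c] /=; case: (boolP (c <= htT y)) => [h|_]; last by exists y.
  by have [z] := forest_proj FT h; exists z.
have [pU pUP] : exists p : U * W -> U, forall z, z.2 <= htU z.1 ->
    p z <= z.1 /\ htU (p z) = z.2.
  apply: (@fun_choice _ _ (fun z y => z.2 <= htU z.1 -> y <= z.1 /\ htU y = z.2)).
  move=> [y c] /=; case: (boolP (c <= htU y)) => [h|_]; last by exists y.
  by have [z] := forest_proj FU h; exists z.
(* The lists follow the three clauses of [amalgam]. Entries of level [d] are projected to the levels
   of [q'] from [d'] on, which is enough because every level of [q] below [d] is a level of [q']. *)
have [L1 L1P] := gr_seq_filter q (fun a => d <= htT a).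
have [L2 L2P] := gr_seq q'.
have [L3 L3P] := gr_seq_filter q (fun a => htT a == d).
pose B := [seq al <- enum_fset (Q_val q').1 | d' <= al].
pose L := L1 ++ L2 ++ [seq (pT (p.1, al), pU (p.2, al)) | p <- L3, al <- B].
have LP a b : (a, b) \in L <->
    F a b /\ htT a \in ((Q_val q).1 `|` (Q_val q').1)%fset.
  rewrite !mem_cat; split.
    move=> /or3P[/L1P[g h]|/L2P g|].
    - by split; [constructor 1|rewrite inE (gr_dom g)].
    - by split; [constructor 2|rewrite inE (gr_dom g) orbT].
    move=> /allpairsP[[[a0 b0] al] [/= /L3P[g /eqP h]]].
    rewrite mem_filter => /andP[d'al alx] [-> ->].
    have ald := q'd _ alx.
    have [|ya yh] := pTP (a0, al); first by rewrite /= h ltW.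
    have [|za zh] := pUP (b0, al); first by rewrite /= (gr_ht g) h ltW.
    rewrite yh inE alx orbT; split=> //; constructor 3; exists a0, b0.
    by rewrite yh zh d'al ald.
  move=> [[[g h]|g|[a0 [b0 [[g h] [aa bb] e /andP[d'a ad]]]]] ax].
  - by apply/or3P; constructor 1; apply/L1P.
  - by apply/or3P; constructor 2; apply/L2P.
  apply/or3P; constructor 3; apply/allpairsP; exists ((a0, b0), htT a) => /=.
  have ax' : htT a \in (Q_val q').1.
    by move: ax; rewrite inE => /orP[|//] /lowx; apply.
  split; first by apply/L3P; rewrite h.
    by rewrite mem_filter d'a.
  have [|ya yh] := pTP (a0, htT a); first by rewrite /= h ltW.
  have [|za zh] := pUP (b0, htT a); first by rewrite /= (gr_ht g) h ltW.
  congr pair; first by apply: (forest_same FT aa ya); rewrite yh.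
  by apply: (forest_same FU bb za); rewrite zh.
have Fht a b : F a b -> htU b = htT a.
  by move=> [[/gr_ht]|/gr_ht|[? [? [_ _ ->]]]].
have [||||w [w1 w2]] := @mkQ ((Q_val q).1 `|` (Q_val q').1)%fset L.
- by move=> al; rewrite inE => /orP[] /Q_limit.
- by move=> a b /LP[h ?]; split=> //; apply: Fht.
- move=> a b c e /LP[h _] /LP[h' _]; split; [exact: Finc h'|exact: Fcni h'].
- move=> a b c /LP[Fab _] ca cx.
  suff [e Fe] : exists e, F c e by exists e; apply/LP.
  (* From [d'] on, [c] is sent to the projection of [b0]; below [d'] its level belongs to [q], whose
     domain is downwards closed. *)
  have from_A a0 b0 : gr q a0 b0 -> htT a0 = d -> c <= a0 -> htT c < d ->
      exists e, F c e.
    move=> g h ca0 cd; case: (leP d' (htT c)) => cd'.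
      have [|e eb eh] := @forest_proj _ _ _ _ _ FU b0 (htT c).
        by rewrite (gr_ht g) h ltW.
      by exists e; constructor 3; exists a0, b0; rewrite eh cd' cd.
    have cx' : htT c \in (Q_val q).1.
      by move: cx; rewrite inE => /orP[//|] /lowx'; apply.
    have [e ge _] := gr_down g ca0 cx'.
    by exists e; constructor 2; apply: low.
  case: Fab => [[g h]|g|[a0 [b0 [[g h] [aa bb] e /andP[d'a ad]]]]].
  + have [a0 [b0 [[g0 h0] aa bb]]] := Gabove _ _ _ _ dq g h.
    case: (ltP (htT c) d) => cd.
      by apply: (from_A _ _ g0 h0 _ cd); apply: (forest_lin FT (ltW ca) aa); rewrite h0 ltW.
    have cx' : htT c \in (Q_val q).1.
      move: cx; rewrite inE => /orP[//|] /q'd; by rewrite ltNge cd.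
    by have [e ge _] := gr_down g (ltW ca) cx'; exists e; constructor 1.
  + have cd : htT c < d.
      by apply: le_lt_trans (forest_ht FT (ltW ca)) (q'd _ (gr_dom g)).
    have cx' : htT c \in (Q_val q').1.
      by move: cx; rewrite inE => /orP[|//] /lowx; apply.
    by have [e ge _] := gr_down g (ltW ca) cx'; exists e; constructor 2.
  + apply: (from_A _ _ g h); first exact: le_trans (ltW ca) aa.
    by apply: le_lt_trans (forest_ht FT (ltW ca)) ad.
exists w; apply/Q_leP; rewrite w1; split.
- by move=> al h; rewrite inE h.
- move=> a b g; apply/w2/LP; split; last by rewrite inE (gr_dom g).
  by case: (leP d (htT a)) => h; [constructor 1|constructor 2; apply: low].
- by move=> al h; rewrite inE h orbT.
- move=> a b g; apply/w2/LP; split; last by rewrite inE (gr_dom g) orbT.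
  by constructor 2.
Qed.

End Conditions.

(** * Reflection of conditions along the Suslin tree *)

Section Reflection.
Context {dW dS dT dU : Order.disp_t}.
Variables (W : orderType dW) (S : porderType dS) (T : porderType dT) (U : porderType dU).
Hypothesis hW : is_omega1 W.
Variables (hts : S -> W) (htT : T -> W) (htU : U -> W).
Hypothesis FS : is_forest (fun x y : S => x <= y) hts.
Hypothesis extS : forall (x : S) (a : W), hts x <= a -> exists2 y, x <= y & hts y = a.
Hypothesis accS : forall A : S -> Prop,
  (forall x y, A x -> A y -> x <= y -> x = y) -> cnt A.
Hypothesis htTE : forall x a, has_height x a <-> htT x = a.
Hypothesis htUE : forall x a, has_height x a <-> htU x = a.
Hypothesis FT : is_forest (fun x y : T => x <= y) htT.
Hypothesis FU : is_forest (fun x y : U => x <= y) htU.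
Hypothesis splitT : forall (x y : T) (d : W), htT x = d -> htT y = d -> is_limit d ->
  x <> y -> exists2 c, c < d & forall z, z <= x -> z <= y -> htT z < c.
Hypothesis splitU : forall (x y : U) (d : W), htU x = d -> htU y = d -> is_limit d ->
  x <> y -> exists2 c, c < d & forall z, z <= x -> z <= y -> htU z < c.
Hypothesis NBT : no_branch_name S (fun x y : T => x <= y) htT.
Hypothesis NBU : no_branch_name S (fun x y : U => x <= y) htU.
Variables (t0 : T) (u0 : U).
Local Notation Q := (Q W T U).

(** A condition is determined by its finite set of levels and a finite list of pairs, and below [a]
    both are drawn from countable sets. *)
Lemma cnt_Q a : cnt (fun q : Q => forall al, al \in (Q_val q).1 -> al < a).
Proof.
have [g gP] := fun_choice (@gr_seq _ _ _ W T U).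
have cT := forest_cnt_lt hW FT a; have cU := forest_cnt_lt hW FU a.
apply: (cnt_inj (f := fun q : Q => (enum_fset (Q_val q).1, g q)) _ _
  (cnt_pair (cnt_seq (W_ini hW a)) (cnt_seq (cnt_pair cT cU)))).
  move=> q qa; split=> [al /qa//|[b c] /gP h] /=.
  by rewrite (gr_ht htTE htUE h) qa // (gr_dom htTE h).
move=> q q' _ _ [/(@val_inj _ _ {fset W}) e1 e2]; apply/eqP; rewrite eq_le; apply/andP.
split; apply/Q_leP; split.
- by rewrite e1.
- by move=> b c /gP; rewrite -e2 => /gP.
- by rewrite e1.
- by move=> b c /gP; rewrite e2 => /gP.
Qed.

Lemma seq_bound (X : eqType) (L : seq X) (P : X -> W -> Prop) (a d : W) : a < d ->
  (forall x b c, b <= c -> P x b -> P x c) ->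
  (forall x, x \in L -> exists2 c, c < d & P x c) ->
  exists2 c, c < d & forall x, x \in L -> P x c.
Proof.
move=> ad mono; elim: L => [|x L IH] h; first by exists a.
have [|c cd cP] := IH; first by move=> y yL; apply: h; rewrite inE yL orbT.
have [b bd bP] := h x (mem_head _ _).
exists (Order.max b c); first by rewrite gt_max bd.
move=> y; rewrite inE => /orP[/eqP->|yL].
  by apply: mono bP; rewrite le_max lexx.
by apply: (mono _ c); [rewrite le_max lexx orbT|apply: cP].
Qed.

(** The entries in [T] come first, so the coordinates of the i-th pair sit at [i] and
    [size A + i]. *)
Definition flat (A : seq (T * U)) : seq (T + U) :=
  [seq inl p.1 | p <- A] ++ [seq inr p.2 | p <- A].

Lemma size_flat A : size (flat A) = (size A).*2.
Proof. by rewrite size_cat !size_map addnn. Qed.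

Lemma nth_flat_l v0 p0 A i : (i < size A)%N -> nth v0 (flat A) i = inl (nth p0 A i).1.
Proof. by move=> iA; rewrite nth_cat size_map iA (nth_map p0). Qed.

Lemma nth_flat_r v0 p0 A i : (i < size A)%N ->
  nth v0 (flat A) (size A + i) = inr (nth p0 A i).2.
Proof.
by move=> iA; rewrite nth_cat size_map ltnNge leq_addr /= addKn (nth_map p0).
Qed.

Lemma Q_reflection (D : nat -> Q -> S -> Prop) (a0 : W) :
  exists d, [/\ a0 < d, is_limit d & forall n q s,
    d \in (Q_val q).1 -> d <= hts s -> D n q s ->
    exists q' s', [/\ D n q' s', s' < s, hts s' < d & Q_compat q q']].
Proof.
have [w0 w0P] := W_bot hW.
pose lev (q : Q) := foldr Order.max w0 (enum_fset (Q_val q).1).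
have levP q d : w0 < d -> (lev q < d) <-> (forall al, al \in (Q_val q).1 -> al < d).
  exact: foldr_max_lt.
(* The tuple [xs] lists the part of [q] on one of its levels [d'], and [k.2] is the part of [q]
   below [d']. *)
pose E (k : nat * Q) (s : S) (xs : seq (T + U)) q := exists d' A,
  [/\ D k.1 q s /\ d' \in (Q_val q).1, restr_below htT q d' k.2, uniq A,
      forall a b, (a, b) \in A <-> gr q a b /\ htT a = d' & xs = flat A].
pose D' k s xs := exists q, E k s xs q.
(* [c] picks one such [q] for each tuple; its levels are the data kept below [d] through the
   argument [e] of [tuple_reflection]. *)
have [c cP] : exists c : nat * Q * S * seq (T + U) -> Q, forall z,
    D' z.1.1 z.1.2 z.2 -> E z.1.1 z.1.2 z.2 (c z).
  apply: (@fun_choice _ _ (fun z q => D' z.1.1 z.1.2 z.2 -> E z.1.1 z.1.2 z.2 q)) => z.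
  case: (pselect (D' z.1.1 z.1.2 z.2)) => [[q h]|n]; first by exists q.
  by exists z.1.1.2.
pose v0 : T + U := inl t0; pose p0 := (t0, u0).
have FV := sum_forest FT FU.
have NB := sum_no_branch_name hts NBT NBU.
have levK a : cnt (fun k : nat * Q => lev k.2 < a).
  case: (boolP (w0 < a)) => [w0a|nw0].
    apply: (cnt_sub _ (cnt_pair (cnt_nat (fun=> True)) (cnt_Q a))) => k /levP h.
    by split=> //; apply: h.
  exists (fun=> 0%N) => k k' ka; case/negP: nw0.
  apply: le_lt_trans ka; exact: w0P.
have [d [a0d dlim dP]] := tuple_reflection hW FS extS accS v0 FV levK D'
  (fun k s xs => lev (c (k, s, xs))) NB a0.
exists d; split=> // n q s dq ds Dq.
have w0d := le_lt_trans (w0P _) a0d.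
have [q0 r0] := restr_below_ex htTE htUE FT FU q d.
have [L LP] := gr_seq_filter q (fun a => htT a == d).
pose A := undup L.
have AP a b : (a, b) \in A <-> gr q a b /\ htT a = d.
  by rewrite mem_undup; split => [/LP[g /eqP]//|[g h]]; apply/LP; rewrite h.
have Ainj p p' : p \in A -> p' \in A -> p.1 = p'.1 \/ p.2 = p'.2 -> p = p'.
  case: p p' => [a b] [a' b'] /AP[g _] /AP[g' _] /= [e|e]; subst.
    by rewrite (gr_fun g g').
  congr pair; apply/eqP; rewrite eq_le.
  by rewrite (gr_iso htTE htUE FT FU g g').2 // (gr_iso htTE htUE FT FU g' g).2.
have Aht p : p \in A -> htT p.1 = d /\ htU p.2 = d.
  by case: p => a b /AP[g <-] /=; rewrite (gr_ht htTE htUE g).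
(* By normality, finitely many applications of [splitT] and [splitU] give one level [gam] below [d]
   above all common predecessors of distinct entries of [A], in both trees. *)
have [gam gd gP] : exists2 gam, gam < d & forall z, z \in [seq (p, p') | p <- A, p' <- A] ->
    z.1 <> z.2 -> (forall x, x <= z.1.1 -> x <= z.2.1 -> htT x < gam) /\
    (forall x, x <= z.1.2 -> x <= z.2.2 -> htU x < gam).
  apply: (seq_bound a0d).
    move=> z b b' bb' h ne; have [h1 h2] := h ne.
    by split=> x x1 x2; apply: lt_le_trans bb'; [apply: h1|apply: h2].
  move=> z /allpairsP[[p p'] [/= pA p'A ->]] /=.
  case: (pselect (p = p')) => [e|ne]; first by exists a0.
  have [pT pU] := Aht _ pA; have [p'T p'U] := Aht _ p'A.
  have [|c1 c1d c1P] := splitT pT p'T dlim.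
    by move=> e; apply: ne; apply: Ainj => //; left.
  have [|c2 c2d c2P] := splitU pU p'U dlim.
    by move=> e; apply: ne; apply: Ainj => //; right.
  exists (Order.max c1 c2); first by rewrite gt_max c1d.
  move=> _; split=> x x1 x2; rewrite lt_max ?(c1P x) // ?(c2P x) // orbT //.
have xsd x : x \in flat A -> sum_ht htT htU x = d.
  by rewrite mem_cat => /orP[] /mapP[p /Aht[h1 h2] ->].
have [ys yx ygam] : exists2 ys, seq_below v0 (sum_le (fun x y : T => x <= y) (fun x y : U => x <= y)) ys (flat A)
    & forall y, y \in ys -> sum_ht htT htU y = gam.
  by apply: (seq_proj v0 FV) => x /xsd ->; apply: ltW.
have Dk : D' (n, q0) s (flat A).
  by exists q, d, A; split=> //; rewrite undup_uniq.
have [||s' [xs' [s's s'd Dx' yx' [ed xd' nle]]]] := dP (n, q0) s (flat A) ys _ ds xsd _ yx Dk.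
- by apply/levP => // al /(proj1 r0)[].
- by move=> y /ygam ->.
have [d' [A' [/= [Dq' dq'] r0' A'u A'P exs]]] := cP (n, q0, s', xs') Dx'.
set q' := c _ in Dq' dq' r0' A'P.
have sA : size A' = size A.
  by apply: double_inj; rewrite -!size_flat -exs -(proj1 yx) -(proj1 yx').
have idx i : (i < size A)%N ->
  [/\ exists y, [/\ y <= (nth p0 A i).1, y <= (nth p0 A' i).1 & htT y = gam],
      exists y, [/\ y <= (nth p0 A i).2, y <= (nth p0 A' i).2 & htU y = gam],
      ~ (nth p0 A' i).1 <= (nth p0 A i).1 & ~ (nth p0 A' i).2 <= (nth p0 A i).2].
  move=> iA; have iA' : (i < size A')%N by rewrite sA.
  have sy : size ys = (size A + size A)%N by rewrite (proj1 yx) size_flat addnn.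
  have i1 : (i < size ys)%N by rewrite sy ltn_addr.
  have i2 : (size A + i < size ys)%N by rewrite sy ltn_add2l.
  have n1 := nle _ i1; have n2 := nle _ i2.
  have l1 := proj2 yx _ i1; have l2 := proj2 yx _ i2.
  have l1' := proj2 yx' _ i1; have l2' := proj2 yx' _ i2.
  have h1 := ygam _ (mem_nth v0 i1); have h2 := ygam _ (mem_nth v0 i2).
  move: n1 n2 l1 l2 l1' l2'; rewrite exs.
  rewrite !(nth_flat_l v0 p0 iA) !(nth_flat_l v0 p0 iA') !(nth_flat_r v0 p0 iA).
  have nr := nth_flat_r v0 p0 iA'; rewrite sA in nr; rewrite !nr /=.
  case: (nth v0 ys i) h1 => //= y yh; case: (nth v0 ys _) h2 => //= z zh.
  by move=> n1 n2 l1 l2 l1' l2'; split=> //; [exists y|exists z].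
exists q', s'; split=> //.
apply: (Q_amalgam htTE htUE FT FU dq dq' r0 r0').
- by apply/levP.
- move=> a b a' b' g h g' h'.
  have pA : (a, b) \in A by apply/AP.
  have pA' : (a', b') \in A' by apply/A'P.
  have /(nthP p0)[i iA ei] := pA; have /(nthP p0)[j jA' ej] := pA'.
  have jA : (j < size A)%N by rewrite -sA.
  have := idx j jA; rewrite ej /= => -[[y [y1 y2 yh]] [z [z1 z2 zh]] n1 n2].
  (* For equal indices [tuple_reflection] gives the claim. Otherwise the projection to [gam] of the
     j-th entry of [A] would also lie below the i-th, against the choice of [gam]. *)
  case: (pselect (i = j)) => [e|ne]; first by subst j; move: n1 n2; rewrite ei.
  have [] := gP ((a, b), nth p0 A j) => [||/= H1 H2].
  + by apply/allpairsP; exists ((a, b), nth p0 A j); rewrite /= mem_nth.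
  + rewrite /= -ei => /eqP; rewrite nth_uniq ?undup_uniq // => /eqP; exact: ne.
  split=> ab.
    by have := H1 y (le_trans y2 ab) y1; rewrite yh ltxx.
  by have := H2 z (le_trans z2 ab) z1; rewrite zh ltxx.
- move=> a b a1 b1 g h g1 h1 ne.
  have pA : (a, b) \in A by apply/AP.
  have p1A : (a1, b1) \in A by apply/AP.
  have gd' : gam <= d'.
    have /(nthP p0)[i iA ei] := pA; have [[y [y1 y2 <-]] _ _ _] := idx i iA.
    have iA' : (i < size A')%N by rewrite sA.
    have := mem_nth p0 iA'; case: (nth p0 A' i) y2 => a2 b2 /= y2 /A'P[_ <-].
    exact: forest_ht FT _ _ y2.
  have [] := gP ((a, b), (a1, b1)) => [||/= H1 H2].
  + by apply/allpairsP; exists ((a, b), (a1, b1)).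
  + by case.
  by split=> x x1 x2; apply: lt_le_trans gd'; [apply: H1|apply: H2].
Qed.

End Reflection.
(** * Forcing *)

Section ForcingFacts.
Context {d : Order.disp_t} (P : porderType d).
Implicit Types (p q r : P) (phi : formula (name P)).

Lemma forces_mono p q phi : q <= p -> forces_at p phi -> forces_at q phi.
Proof.
elim: phi p q => [A|X x B|f IH|f IHf g IHg|f IHf g IHg|f IHf g IHg|X f IH|X f IH|
  X f IH|X f IH] p q qp //=.
- by move=> h r rq; apply: h; apply: le_trans qp.
- by move=> h r rq; apply: h; apply: le_trans qp.
- by move=> [h1 h2]; split; [apply: IHf h1|apply: IHg h2].
- by move=> h r rq; apply: h; apply: le_trans qp.
- by move=> h r rq; apply: h; apply: le_trans qp.
- by move=> h x; apply: IH (h x).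
- by move=> h r rq; apply: h; apply: le_trans qp.
- by move=> h x; apply: IH (h x).
- by move=> h r rq; apply: h; apply: le_trans qp.
Qed.

Lemma forces_dense p phi :
  (forall q, q <= p -> exists2 r, r <= q & forces_at r phi) -> forces_at p phi.
Proof.
elim: phi p => [A|X x B|f IH|f IHf g IHg|f IHf g IHg|f IHf g IHg|X f IH|X f IH|
  X f IH|X f IH] p h /=.
- by have [r _] := h p (lexx p).
- move=> q /h[r rq /(_ r (lexx r)) [r' r'r e]]; exists r' => //; exact: le_trans rq.
- move=> q qp fq; have [r rq /(_ r (lexx r))] := h q qp; apply.
  exact: forces_mono fq.
- by split; [apply: IHf|apply: IHg] => q /h[r rq [h1 h2]]; exists r.
- move=> q /h[r rq /(_ r (lexx r)) [r' r'r e]]; exists r' => //; exact: le_trans rq.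
- move=> q qp fq; apply: IHg => q' q'q.
  have [r rq' fg] := h q' (le_trans q'q qp); exists r => //.
  by apply: (fg r) => //; apply: forces_mono fq; apply: le_trans q'q.
- by move=> x; apply: IH => q /h[r rq fr]; exists r.
- move=> q /h[r rq /(_ r (lexx r)) [r' r'r e]]; exists r' => //; exact: le_trans rq.
- by move=> x; apply: IH => q /h[r rq fr]; exists r.
- move=> q /h[r rq /(_ r (lexx r)) [r' r'r e]]; exists r' => //; exact: le_trans rq.
Qed.

Definition check (X : Type) (B : X -> Prop) : name P X := fun x _ => B x.

Lemma forces_mem_check (X : Type) (B : X -> Prop) (x : X) p :
  forces_at p (x ∈ check B)%F <-> B x.
Proof.
split=> [h|Bx q qp]; first by have [r _ [s]] := h p (lexx p).
by exists q => //; exists q.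
Qed.

Lemma forces_exsub (X : Type) (f : name P X -> formula (name P)) (B : name P X) p :
  forces_at p (f B) -> forces_at p (ExSub f).
Proof. by move=> h q qp; exists q => //; exists B; apply: forces_mono h. Qed.

(** The check name of the graph of a ground-model injection still witnesses countability. *)
Lemma forces_countable (X : Type) (A : X -> formula (name P)) (A0 : X -> Prop) p :
  cnt A0 -> (forall q x, q <= p -> forces_at q (A x) -> A0 x) ->
  forces_at p (countableF A).
Proof.
move=> [f fI] AA0; apply: (@forces_exsub _ _ (check (fun z => A0 z.1 /\ f z.1 = z.2))).
split; [|split].
- move=> x q qp /(AA0 q x qp) Ax; move=> q' _; exists q' => //.
  by exists (f x); apply/forces_mem_check.
- by move=> x m n q _ [] /forces_mem_check/= [_ <-] /forces_mem_check/= [_ <-].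
- move=> x y n q _ [] /forces_mem_check/= [Ax <-] /forces_mem_check/= [Ay e].
  exact: fI.
Qed.

Lemma forces_height {dW dT : Order.disp_t} (W : orderType dW) (T : porderType dT)
    (x : T) (a : W) p : has_height x a -> forces_at p (heightF (name P) x a).
Proof.
move=> [R [Rt [Rs Ro]]]; apply: (@forces_exsub _ _ (check R)).
split; [|split].
- move=> y q _ /= /Rt[b [ba h]]; move=> q' _; exists q' => //.
  by exists b; split=> //; apply/forces_mem_check.
- move=> b q _ /= /Rs[y [ba h]]; move=> q' _; exists q' => //.
  by exists y; split=> //; apply/forces_mem_check.
- move=> y z b c q _ [yx [zx [ba [ca [/forces_mem_check h1 /forces_mem_check h2]]]]].
  have [i1 i2] := Ro y z b c (conj yx (conj zx (conj ba (conj ca (conj h1 h2))))).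
  by split=> r _.
Qed.

(** Apply well-foundedness in the ground model to the elements that some condition below [q'] forces
    into [B]. A condition forcing the least such element below [x] into [B] also forces it to be the
    minimum. *)
Lemma forces_tree {dT : Order.disp_t} (T : porderType dT) p :
  holds (fun Name => treeF Name T) -> forces_at p (treeF (name P) T).
Proof.
move=> tT x B q qp h q' q'q.
have [r rq' [y [yB yx]]] := h q' q'q.
have [|z [[r' r'q' zB] [zx zm]]] := @tT x (fun y => exists2 r, r <= q' & forces_at r (y ∈ B)%F).
  by exists y; split=> //; exists r.
exists r' => //; exists z; split=> //; split=> // w u ur' [wB wx].
by apply: zm; split=> //; exists u => //; apply: le_trans r'q'.
Qed.

Lemma forces_min {dW : Order.disp_t} (W : orderType dW) (hW : is_omega1 W) p :
  forces_at p (∀ B ⊆ W, (∃ a : W, a ∈ B) ⇒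
     ∃ a : W, a ∈ B ∧ (∀ b : W, b ∈ B ⇒ ⌜a <= b⌝))%F.
Proof.
move=> B q qp h q' q'q; have [r rq' [y yB]] := h q' q'q.
have [|z [r' r'q' zB] zm] := W_min hW (A := fun y => exists2 r, r <= q' & forces_at r (y ∈ B)%F).
  by exists y, r.
exists r' => //; exists z; split=> // w u ur' wB.
by apply: zm; exists u => //; apply: le_trans r'q'.
Qed.

End ForcingFacts.

(** Read as an [S^d]-name, [B] would be forced by [s0] to be a cofinal branch. Maximality comes from
    meeting every level: an element comparable with the whole chain equals the member of the chain
    at its height. *)
Lemma forces_no_branch {dW dS dT : Order.disp_t} (W : orderType dW) (S : porderType dS)
    (T : porderType dT) (ht : T -> W) :
  (forall x a, has_height x a <-> ht x = a) ->
  is_forest (fun x y : T => x <= y) ht ->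
  (forall s : S^d%type, forces_at s (AronszajnF (name S^d%type) W T)) ->
  no_branch_name S (fun x y : T => x <= y) ht.
Proof.
move=> htE F forced s0 B mono meets ch.
have nb : ~ forces_at (s0 : S^d%type) (ExSub (fun B => cofinal_branchF (T := T) W B)).
  by have [_ [_ [_ h]]] := forced s0; apply: (h s0 (lexx _)).
have memB (t u : S^d%type) x : forces_at t (x ∈ (B : name S^d%type T))%F -> u <= t ->
    exists2 t' : S, (u : S) <= t' & B x t'.
  move=> h ut; have [t' tt' [s st' Bs]] := h u ut; exists t' => //.
  exact: mono Bs.
apply: nb; apply: (@forces_exsub _ _ _ _ (B : name S^d%type T)).
split; [|split].
- move=> x y q qs [xB yB] q' q'q; exists q' => //.
  have qs' : s0 <= (q : S) := qs; have q'q' : (q : S) <= (q' : S) := q'q.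
  have [t q't Bt] := memB q q' x xB q'q.
  have [u tu Bu] := memB q t y yB (le_trans q'q' q't).
  apply: (ch u) => //; last exact: mono Bt.
  exact: le_trans (le_trans (le_trans qs' q'q') q't) tu.
- move=> x q qs h q' q'q.
  have qs' : s0 <= (q : S) := qs; have q'q' : (q : S) <= (q' : S) := q'q.
  have [t [y [q't By yx]]] := meets q' (ht x) (le_trans qs' q'q').
  exists (t : S^d%type) => //; exists (t : S^d%type) => //.
  have [|r _] := h y t (le_trans q'q' q't) _ t (lexx _).
    by move=> u ut; exists u => //; exists u => //; apply: mono By.
  case=> /= l; first by rewrite (forest_eq F l (esym yx)).
  by rewrite -(forest_eq F l yx).
- move=> a q qs; have qs' : s0 <= (q : S) := qs.
  have [t [y [qt By ya]]] := meets q a qs'.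
  exists (t : S^d%type) => //; exists y; split; last exact/forces_height/htE.
  by move=> u ut; exists u => //; exists u => //; apply: mono By.
Qed.

Theorem theorem3p10 (dW dS dT dU : Order.disp_t) (W : orderType dW)
    (S : porderType dS) (T : porderType dT) (U : porderType dU)
    (hW : holds (omega1 W))
    (hS : holds (Suslin W S)) (nS : normal W S)
    (hT : holds (Aronszajn W T)) (nT : normal W T)
    (hU : holds (Aronszajn W U)) (nU : normal W U)
    (hTU : forces (S^d)%type 
       (fun Name => AronszajnF Name W T ∧ AronszajnF Name W U)%F) :
  forces (Q W T U) (Suslin W S).
Proof.
have oW := omega1P hW.
have aron (d : Order.disp_t) (V : porderType d) : holds (Aronszajn W V) ->
    exists ht : V -> W, (forall x a, has_height x a <-> ht x = a) /\
      is_forest (fun x y : V => x <= y) ht.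
  move=> [tV [[_ [hts _]] [cV _]]]; apply: (tree_is_forest oW tV hts) => a.
  exact: (countableF_cnt (fun x : V => heightF set x a)).1 (cV a).
have [htT [htTE FT]] := aron _ T hT.
have [htU [htUE FU]] := aron _ U hU.
have [tS [[_ [totS levS]] susS]] := hS.
have accS (A : S -> Prop) : (forall x y, A x -> A y -> x <= y -> x = y) -> cnt A.
  move=> anti; apply: (countableF_cnt (fun x => (x ∈ (A : set S))%F)).1.
  apply: susS; right => x y [Ax [Ay ne]]; split=> h; apply: ne; first exact: anti.
  by apply: esym; apply: anti.
have [hts [htsE FS]] : exists ht : S -> W, (forall x a, has_height x a <-> ht x = a) /\
      is_forest (fun x y : S => x <= y) ht.
  apply: (tree_is_forest oW tS totS) => a; apply: accS => x y xa ya.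
  rewrite le_eqVlt => /orP[/eqP//|xy].
  have [/(_ x xy) [b ba xb] _] := has_height_lt ya.
  by rewrite (height_uniq oW xa xb) ltxx in ba.
have extS := normal_ext htsE nS.
have NBT : no_branch_name S (fun x y : T => x <= y) htT.
  by apply: forces_no_branch => // s; have [] := hTU s.
have NBU : no_branch_name S (fun x y : U => x <= y) htU.
  by apply: forces_no_branch => // s; have [] := hTU s.
have [[t0 _] _ _ _] := nT; have [[u0 _] _ _ _] := nU.
have refl := Q_reflection oW FS extS accS htTE htUE FT FU
  (normal_split FT nT) (normal_split FU nU) NBT NBU t0 u0.
(* Adding the level [d] to [r0] makes the reflection property available to every condition below
   [r1]. *)
have reach (D : nat -> Q W T U -> S -> Prop) (r0 : Q W T U) : exists d r1,
    [/\ r1 <= r0, d \in (Q_val r1).1 & forall n q s, q <= r1 -> d <= hts s -> D n q s ->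
    exists q' s', [/\ D n q' s', s' < s, hts s' < d & Q_compat q q']].
  have [a aP] := cnt_bounded oW (cnt_mem (enum_fset (Q_val r0).1)).
  have [d [ad dlim dP]] := refl D a.
  have [|r1 r10 dr1] := Q_add_level htTE htUE FT FU (q := r0) dlim.
    by move=> al /aP h; apply: lt_trans ad.
  by exists d, r1; split=> // n q s /Q_leP[sub _]; apply: dP; apply: sub.
move=> p; split; first exact: forces_tree.
split; [split; [|split]|].
- split; first exact: forces_min.
  split; first by move=> a; apply: (forces_countable (W_ini oW a)) => q x _.
  (* [r0] forces [R] to inject [W] into the natural numbers. Once [r2] decides the value [n] at [d],
     reflection yields a compatible condition giving the same [n] to a smaller height. *)
  move=> q _ /(_ q (lexx _)) [r0 _ [R [Rt [_ Ri]]]].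
  have [d [r1 [r10 dr1 dP]]] := reach (fun n q s => q <= r0 /\
    forces_at q ((hts s, n) ∈ R)%F) r0.
  have [s /htsE sd] := levS d.
  have [r2 r21 [n Rn]] := Rt d r1 r10 I r1 (lexx _).
  have [||q' [s' [[q'r0 Rn'] _ s'd [w wr2 wq']]]] := dP n r2 s r21; first by rewrite sd.
    by rewrite sd; split=> //; apply: le_trans r10.
  have e : d = hts s'.
    apply: (Ri d (hts s') n w (le_trans wq' q'r0)).
    split; first exact: (forces_mono (phi := ((d, n) ∈ R)%F) wr2 Rn).
    exact: (forces_mono (phi := ((hts s', n) ∈ R)%F) wq' Rn').
  by rewrite -e ltxx in s'd.
- move=> x; have [a xa] := totS x; move=> q _; exists q => //; exists a.
  exact: forces_height.
- move=> a; have [x xa] := levS a; move=> q _; exists q => //; exists x.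
  exact: forces_height.
- move=> B q _ hB; change (forces_at q (countableF (fun x : S => x ∈ B)%F)).
  apply: forces_dense => q0 q0q.
  have [r0 r0q0 hr0] := hB q0 q0q.
  suff [d [r1 [r10 dP]]] : exists d r1, r1 <= r0 /\ forall w s, w <= r1 ->
      forces_at w (s ∈ B)%F -> hts s < d.
    exists r1; first exact: le_trans r0q0.
    by apply: (forces_countable (forest_cnt_lt oW FS d)) => w s; apply: dP.
  case: hr0 => [chain|anti].
    have [d [r1 [r10 dr1 dP]]] := reach (fun _ q s =>
      exists u, [/\ q <= r0, forces_at q (u ∈ B)%F, ~ u <= s & ~ s <= u]) r0.
    (* The bound is a level above [d], so that [s] is strictly above its projection [v] to level
       [d]. *)
    have [d' dd'] := W_gt oW d.
    exists d', r1; split=> // w s wr1 sB; apply: le_lt_trans dd'.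
    rewrite leNgt; apply/negP => ds.
    have [v vs vd] := forest_proj FS (ltW ds).
    have vs' : v < s.
      by rewrite lt_neqAle vs andbT; apply/eqP => e; rewrite -e vd ltxx in ds.
    (* At most one of two immediate successors of [v] is below [s]. The other is incomparable with
       [s], so [s] witnesses that the pair of [w] and [y] is among those to be reflected. *)
    have [y [yv ys]] : exists y, immediate_succ v y /\ ~ y <= s.
      have [_ /(_ v) [y [z [yz iy iz]]] _ _] := nS.
      case: (pselect (y <= s)) => [ys|]; last by exists y.
      case: (pselect (z <= s)) => [zs|]; last by exists z.
      have [vy ny] := iy; have [vz nz] := iz.
      case: (forest_comp FS ys zs) => l.
        by case: nz; exists y; rewrite vy lt_neqAle l andbT; apply/eqP.
      by case: ny; exists z; rewrite vz lt_neqAle l andbT; apply/eqP => e; apply: yz.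
    have [vy ny] := yv.
    have sy : ~ s <= y.
      rewrite le_eqVlt => /orP[/eqP e|sy]; first by apply: ys; rewrite e.
      by apply: ny; exists s; rewrite vs'.
    have dy : d <= hts y by rewrite -vd; apply: (forest_ht FS (ltW vy)).
    have [|q' [s' [[u [q'r0 uB us' s'u]] s'y s'd [x xw xq']]]] := dP 0%N w y wr1 dy.
      by exists s; split=> //; apply: le_trans r10.
    (* Both [u] and [s] are forced into the chain by a common extension, hence comparable. As [s']
       is below [s], either order of [u] and [s] makes [u] comparable with [s'], a contradiction. *)
    have s's : s' <= s.
      apply: le_trans vs; apply: (forest_lin FS (ltW s'y) (ltW vy)).
      by rewrite vd ltW.
    have [] := chain s u x (le_trans xq' q'r0) _ x (lexx _).
      split; first exact: (forces_mono (phi := (s ∈ B)%F) xw sB).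
      exact: (forces_mono (phi := (u ∈ B)%F) xq' uB).
    move=> x' _ [/= l|/= l]; first by apply: s'u; apply: le_trans l.
    by case: (forest_comp FS l s's).
  (* Reflecting an [s] of height at least [d] gives [s' < s] such that a common extension forces
     both into the antichain. *)
  have [d [r1 [r10 dr1 dP]]] := reach (fun _ q s => q <= r0 /\ forces_at q (s ∈ B)%F) r0.
  exists d, r1; split=> // w s wr1 sB; rewrite ltNge; apply/negP => ds.
  have [|q' [s' [[q'r0 s'B] s's s'd [x xw xq']]]] := dP 0%N w s wr1 ds.
    by split=> //; apply: le_trans r10.
  have [] := anti s s' x (le_trans xq' q'r0).
    split; first exact: (forces_mono (phi := (s ∈ B)%F) xw sB).
    split; first exact: (forces_mono (phi := (s' ∈ B)%F) xq' s'B).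
    by move=> x' _ /= e; rewrite e ltxx in s's.
  by move=> _ /(_ x (lexx _)); apply; apply: ltW.
Qed.
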